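(* Let $n\ge 1$, and let $f,g\in\mathbb{C}[x_1,\ldots,x_n]$ be two weighted homogeneous polynomials of the same degree $d$ with respect to the same positive weights $(w_1,\ldots,w_n)$. If their Milnor algebras $M(f)$ and $M(g)$ are isomorphic as graded $\mathbb{C}$-algebras, then $f$ and $g$ are right-equivalent ($\mathcal{R}$-equivalent), i.e. there exists a diffeomorphism $\psi:\mathbb{C}^n\to\mathbb{C}^n$ such that $f\circ\psi=g$.
   Context: Weights $w_1,\ldots,w_n$ are positive real numbers. A polynomial $f\in\mathbb{C}[x_1,\ldots,x_n]$, regarded as a function $f:(\mathbb{C}^n,0)\to(\mathbb{C},0)$ (so $f(0)=0$), is weighted homogeneous of degree $d$ with respect to the weights $(w_1,\ldots,w_n)$ if $f(\lambda^{w_1}x_1,\ldots,\lambda^{w_n}x_n)=\lambda^d f(x_1,\ldots,x_n)$ for all real $\lambda>0$; equivalently, every monomial $x_1^{k_1}\cdots x_n^{k_n}$ occurring in $f$ with nonzero coefficient satisfies $w_1k_1+\cdots+w_nk_n=d$. The Jacobian ideal of $f$ is $\mathcal{J}_f=\langle \partial f/\partial x_1,\ldots,\partial f/\partial x_n\rangle\subset\mathbb{C}[x_1,\ldots,x_n]$, and the Milnor algebra of $f$ is $M(f)=\mathbb{C}[x_1,\ldots,x_n]/\mathcal{J}_f$. The ring $\mathbb{C}[x_1,\ldots,x_n]$ is graded by giving the monomial $x_1^{k_1}\cdots x_n^{k_n}$ degree $w_1k_1+\cdots+w_nk_n$; for weighted homogeneous $f$ the ideal $\mathcal{J}_f$ is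 homogeneous for this grading, and $M(f)$ carries the induced grading. An isomorphism of graded $\mathbb{C}$-algebras is a degree-preserving $\mathbb{C}$-algebra isomorphism. The polynomials are arbitrary: no isolated-singularity assumption is made. ''Diffeomorphism'' is meant in the complex analytic sense, i.e. a biholomorphic map. *)

(* Defs.v *)
From HB Require Import structures.
From mathcomp Require Import all_boot all_order all_algebra.
From mathcomp Require Import generic_quotient ring_quotient complex.
From mathcomp Require Import all_classical all_reals all_analysis.
(* The notations of mpoly clash with those of all_analysis. *)
From mathcomp Require Import -(notations) mpoly.

Set Implicit Arguments.
Unset Strict Implicit.
Unset Printing Implicit Defensive.

Import Order.TTheory GRing.Theory Num.Theory.
Import numFieldNormedType.Exports.

Local Open Scope ring_scope.
Local Open Scope quotient_scope.

Section JacobianIdeal.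
Variables (n : nat) (K : fieldType).
Implicit Types f p q : mpoly n K.

Definition jacobian_ideal f : {pred mpoly n K} :=
  fun p => `[< exists h : 'I_n -> mpoly n K, p = \sum_(i < n) h i * mderiv i f >].

Lemma jacobian_idealP f p :
  reflect (exists h : 'I_n -> mpoly n K, p = \sum_(i < n) h i * mderiv i f)
          (p \in jacobian_ideal f).
Proof. exact: asboolP. Qed.

Fact jacobian_ideal_zmod_closed f : zmod_closed (jacobian_ideal f).
Proof.
split=> [|p q /jacobian_idealP[h ->] /jacobian_idealP[k ->]].
  apply/jacobian_idealP; exists (fun=> 0).
  by rewrite big1 // => i _; rewrite mul0r.
apply/jacobian_idealP; exists (fun i => h i - k i).
by rewrite -sumrB; apply: eq_bigr => i _; rewrite mulrBl.
Qed.

HB.instance Definition _ f :=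
  GRing.isZmodClosed.Build (mpoly n K) (jacobian_ideal f)
    (jacobian_ideal_zmod_closed f).

Lemma jacobian_idealMl f p q :
  q \in jacobian_ideal f -> p * q \in jacobian_ideal f.
Proof.
move=> /jacobian_idealP[h ->]; apply/jacobian_idealP; exists (fun i => p * h i).
by rewrite mulr_sumr; apply: eq_bigr => i _; rewrite mulrA.
Qed.

End JacobianIdeal.

(* The Jacobian ideal may be the whole ring (e.g. for f = 'X_0), in which case  *)
(* the Milnor algebra is the zero ring. The library puts a ring structure on    *)
(* [{ideal_quot I}] only for proper I, so only its zmodType structure is used   *)
(* and the possibly trivial ring and module structures are built on top of it.  *)
Definition milnor (n : nat) (K : fieldType) (f : mpoly n K) : Type :=
  {ideal_quot (jacobian_ideal f)}.

Section MilnorAlgebra.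
Variables (n : nat) (K : fieldType) (f : mpoly n K).
Implicit Types p q : mpoly n K.

HB.instance Definition _ := Choice.on (milnor f).
HB.instance Definition _ := GRing.Zmodule.on (milnor f).

Definition milnor_pi p : milnor f := \pi_{ideal_quot (jacobian_ideal f)} p.

Let repr_milnor (x : milnor f) : mpoly n K := repr (x : {ideal_quot (jacobian_ideal f)}).

Let milnor_reprK : cancel repr_milnor milnor_pi.
Proof. exact: reprK. Qed.

Lemma milnor_pi_surj (x : milnor f) : exists p, milnor_pi p = x.
Proof. by exists (repr_milnor x); rewrite milnor_reprK. Qed.

Lemma milnor_piE p q : milnor_pi p = milnor_pi q <-> p - q \in jacobian_ideal f.
Proof.
split=> [pq|pq].
  by rewrite Quotient.idealrBE; apply/eqP.
by apply/eqP; rewrite /milnor_pi -Quotient.idealrBE.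
Qed.

Fact milnor_pi_is_zmod_morphism : zmod_morphism milnor_pi.
Proof. exact: raddfB. Qed.

Definition milnor_one : milnor f := milnor_pi 1.
Definition milnor_mul (x y : milnor f) : milnor f :=
  milnor_pi (repr_milnor x * repr_milnor y).
Definition milnor_scale (c : K) (x : milnor f) : milnor f :=
  milnor_pi (c *: repr_milnor x).

Let repr_piB p : repr_milnor (milnor_pi p) - p \in jacobian_ideal f.
Proof. by apply/milnor_piE; rewrite milnor_reprK. Qed.

Let mulE p q : milnor_mul (milnor_pi p) (milnor_pi q) = milnor_pi (p * q).
Proof.
apply/milnor_piE.
set p' := repr_milnor _; set q' := repr_milnor _.
have -> : p' * q' - p * q = q' * (p' - p) + p * (q' - q).
  by rewrite !mulrBr [q' * p]mulrC [q' * p']mulrC subrKA.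
by rewrite rpredD // jacobian_idealMl // repr_piB.
Qed.

Let scaleE c p : milnor_scale c (milnor_pi p) = milnor_pi (c *: p).
Proof.
by apply/milnor_piE; rewrite -scalerBr -mul_mpolyC jacobian_idealMl // repr_piB.
Qed.

Fact milnor_mulA : associative milnor_mul.
Proof.
move=> x y z; rewrite -[x]milnor_reprK -[y]milnor_reprK -[z]milnor_reprK.
by rewrite !mulE mulrA.
Qed.

Fact milnor_mulC : commutative milnor_mul.
Proof. by move=> x y; rewrite /milnor_mul mulrC. Qed.

Fact milnor_mul1 : left_id milnor_one milnor_mul.
Proof. by move=> x; rewrite -[x]milnor_reprK mulE mul1r. Qed.

Fact milnor_mulDl : left_distributive milnor_mul +%R.
Proof.
have piD p q : milnor_pi p + milnor_pi q = milnor_pi (p + q).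
  exact/esym/raddfD.
move=> x y z; rewrite -[x]milnor_reprK -[y]milnor_reprK -[z]milnor_reprK.
by rewrite piD !mulE piD mulrDl.
Qed.

HB.instance Definition _ := GRing.Zmodule_isComPzRing.Build (milnor f)
  milnor_mulA milnor_mulC milnor_mul1 milnor_mulDl.

HB.instance Definition _ := GRing.isZmodMorphism.Build (mpoly n K) (milnor f)
  milnor_pi milnor_pi_is_zmod_morphism.

Fact milnor_pi_is_monoid_morphism : monoid_morphism milnor_pi.
Proof. by split=> // p q; rewrite -mulE. Qed.

HB.instance Definition _ := GRing.isMonoidMorphism.Build (mpoly n K) (milnor f)
  milnor_pi milnor_pi_is_monoid_morphism.

Fact milnor_scaleA a b x :
  milnor_scale a (milnor_scale b x) = milnor_scale (a * b) x.
Proof. by rewrite -[x]milnor_reprK !scaleE scalerA. Qed.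

Fact milnor_scale1 : left_id 1 milnor_scale.
Proof. by move=> x; rewrite -[x]milnor_reprK scaleE scale1r. Qed.

Fact milnor_scaleDr : right_distributive milnor_scale +%R.
Proof.
move=> c x y; rewrite -[x]milnor_reprK -[y]milnor_reprK.
by rewrite -raddfD !scaleE scalerDr raddfD.
Qed.

Fact milnor_scaleDl x : {morph milnor_scale^~ x : a b / a + b}.
Proof.
by move=> a b; rewrite -[x]milnor_reprK !scaleE scalerDl raddfD.
Qed.

HB.instance Definition _ := GRing.Zmodule_isLmodule.Build K (milnor f)
  milnor_scaleA milnor_scale1 milnor_scaleDr milnor_scaleDl.

Fact milnor_pi_is_scalable : scalable milnor_pi.
Proof. by move=> c p; rewrite -scaleE. Qed.

HB.instance Definition _ := GRing.isScalable.Build K (mpoly n K) (milnor f) *:%R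
  milnor_pi milnor_pi_is_scalable.

Lemma milnor_scaleAl (c : K) (x y : milnor f) : c *: (x * y) = (c *: x) * y.
Proof.
rewrite -[x]milnor_reprK -[y]milnor_reprK.
have piM p q : milnor_pi p * milnor_pi q = milnor_pi (p * q) by exact: mulE.
have piZ p : c *: milnor_pi p = milnor_pi (c *: p) by exact: scaleE.
by rewrite piM !piZ piM scalerAl.
Qed.

End MilnorAlgebra.

Section Weights.
Variables (R : realType) (n : nat) (w : 'I_n -> R).
Implicit Types f g : mpoly n R[i].

Definition weighted_homogeneous (d : R) f : Prop :=
  forall (t : R) (x : 'I_n -> R[i]), 0 < t ->
    meval (fun i => (t `^ w i)%:C%C * x i) f = (t `^ d)%:C%C * meval x f.

Definition wdeg (m : multinom n) : R := \sum_(i < n) w i * (m i)%:R.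

(* The homogeneous component of degree e of the graded polynomial ring; as the  *)
(* weights are real, so are the degrees. It contains 0 for every e.             *)
Definition wpart (e : R) : set (mpoly n R[i]) :=
  [set p | forall m : multinom n, mcoeff m p != 0 -> wdeg m = e]%classic.

Definition milnor_part f (e : R) : set (milnor f) :=
  (milnor_pi f @` wpart e)%classic.
Arguments milnor_part : clear implicits.

Definition milnor_graded_iso f g : Prop :=
  exists phi : {rmorphism milnor f -> milnor g},
    [/\ scalable phi, bijective phi &
        forall (e : R) (x : milnor f),
          milnor_part f e x -> milnor_part g e (phi x)].

End Weights.
Arguments milnor_part {R n} w f e _.

Section RightEquivalence.
Variables (R : realType) (n : nat).
Implicit Types psi : 'rV[R[i]]_n -> 'rV[R[i]]_n.

(* The scalar field being R[i], [differentiable] is complex differentiability. *)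
Definition holomorphic psi : Prop := forall z, differentiable psi z.

Definition biholomorphic psi : Prop :=
  holomorphic psi /\
  exists phi, [/\ holomorphic phi, cancel psi phi & cancel phi psi].

Definition right_equivalent (f g : mpoly n R[i]) : Prop :=
  exists2 psi, biholomorphic psi &
    forall z, meval (psi z ord0) f = meval (z ord0) g.

End RightEquivalence.

(* Main.v *)
From HB Require Import structures.
Require Import Defs.
From mathcomp Require Import all_boot all_order all_algebra complex.
From mathcomp Require Import all_classical all_reals all_analysis.
From mathcomp Require Import -(notations) mpoly.
From mathcomp Require Import perm zify ring lra.

Set Implicit Arguments.
Unset Strict Implicit.
Unset Printing Implicit Defensive.

Import Order.TTheory GRing.Theory Num.Theory.
Import numFieldNormedType.Exports.
Local Open Scope ring_scope.

(** Only graded polynomial automorphisms of the affine space are needed: the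
    diffeomorphism is found among the substitutions sending each variable x_i
    to a weighted homogeneous polynomial of degree w_i.

    Reduction to equal Jacobian ideals. An isomorphism of the Milnor algebras
    lifts to a graded endomorphism phi of the polynomial ring, such that every
    variable is in the image of phi modulo J_g ([milnor_iso_lift]). The lift
    phi need not be invertible, because J_g may contain linear terms; but phi
    may be corrected by elements of J_g, whose linear parts (when g is
    critical at 0) are the combinations of the rows of the Hessian of g at 0.
    Since phi is onto modulo J_g, its linear part is onto modulo this row
    space, and over a field this is enough to complete it to an invertible
    matrix ([block_complete]). A graded endomorphism with invertible linear
    part is an automorphism ([graded_inverse]), hence f may be replaced by an
    equivalent polynomial that has the same Jacobian ideal as g
    ([milnor_iso_aut]).

    Equal Jacobian ideals. Put e = g - f and f_t = f + t e for complex t.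
    The gradient of f_t is (1 + t B) grad f for a graded matrix B over the
    polynomial ring. Its determinant has degree 0, so it is a polynomial D(t)
    with D(0) = 1, and for D(t) <> 0 the derivatives of e lie in the Jacobian
    ideal of f_t ([jacobian_ideal_pencil]). Near such a t the class of f_t is
    constant ([local_equiv]): by the Euler formula e = xi_s (f_t + s e) for
    a graded vector field xi_s that is analytic in s, and the flow of xi_s
    carries f_t to f_t + s e. This flow is built as a formal power series in s
    ([flow_exists]); it is multiplicative because a product of two solutions of
    the flow equation is again a solution ([flow_cauchy_prod]), and its
    coefficients are geometrically bounded ([pnorm_flow]), so that for small s
    it sums to an honest graded automorphism ([flow_integration]).

    Since D has finitely many roots, almost every point 1/2 + i l can be
    joined to 0 by a segment avoiding them ([avoid_roots]), so f is equivalent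
    to f_b for b = 1/2 + i l; exchanging f and g shows that g is equivalent to
    the same f_b ([jacobian_ideal_equiv]). *)

(** * Substitution of polynomials *)

Definition mvar (n : nat) (K : nzRingType) (i : 'I_n) : mpoly n K :=
  mpolyX K (mnm1 i).
Arguments mvar {n K} i.

Lemma mpoly_ring_ind (n : nat) (K : comNzRingType) (P : mpoly n K -> Prop) :
    (forall c, P (mpolyC n c)) ->
    (forall i p, P p -> P (mvar i * p)) ->
    (forall p q, P p -> P q -> P (p + q)) ->
  forall p, P p.
Proof.
move=> PC PM PD p; rewrite [p]mpolyE.
apply: (big_ind P) => // [|m _]; first by rewrite -(mpolyC0 n); exact: PC.
rewrite -mul_mpolyC mpolyXE_id.
suff: forall s : seq 'I_n, P (mpolyC n (mcoeff m p) * \prod_(i <- s) mvar i ^+ m i).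
  by move/(_ (index_enum 'I_n)).
elim=> [|i s IHs]; first by rewrite big_nil mulr1.
rewrite big_cons; elim: (m i) => [|k IHk]; first by rewrite expr0 mul1r.
by rewrite exprS -mulrA mulrCA; exact: PM.
Qed.

Lemma eq_linear_mpoly (n : nat) (K : nzRingType) (V : lmodType K)
    (f g : {linear mpoly n K -> V}) :
  (forall m, f (mpolyX K m) = g (mpolyX K m)) -> f =1 g.
Proof.
move=> fg p; rewrite [p]mpolyE (raddf_sum f) (raddf_sum g).
by apply: eq_bigr => m _ /=; rewrite !linearZ fg.
Qed.

Definition subst (n : nat) (K : comNzRingType) (phi : 'I_n -> mpoly n K)
  (p : mpoly n K) : mpoly n K := comp_mpoly (mktuple phi) p.

Section Subst.
Variables (n : nat) (K : comNzRingType).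
Implicit Types (phi psi : 'I_n -> mpoly n K) (p q : mpoly n K).

HB.instance Definition _ phi :=
  GRing.LRMorphism.copy (subst phi) (comp_mpoly (mktuple phi)).

Lemma substM phi : {morph subst phi : p q / p * q}.
Proof. exact: rmorphM. Qed.

Lemma substD phi : {morph subst phi : p q / p + q}.
Proof. exact: raddfD. Qed.

Lemma substZ phi c p : subst phi (c *: p) = c *: subst phi p.
Proof. exact: linearZ. Qed.

Lemma subst_sum phi (I : Type) (r : seq I) (P : pred I) (F : I -> mpoly n K) :
  subst phi (\sum_(i <- r | P i) F i) = \sum_(i <- r | P i) subst phi (F i).
Proof. exact: raddf_sum. Qed.

Lemma substV phi i : subst phi (mvar i) = phi i.
Proof. by rewrite /subst comp_mpolyXU -tnth_nth tnth_mktuple. Qed.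

Lemma substC phi c : subst phi (mpolyC n c) = mpolyC n c.
Proof. exact: comp_mpolyC. Qed.

Lemma substX phi m : subst phi (mpolyX K m) = \prod_i phi i ^+ m i.
Proof.
by rewrite /subst comp_mpolyX; apply: eq_bigr => i _; rewrite tnth_mktuple.
Qed.

Lemma eq_subst phi psi : phi =1 psi -> subst phi =1 subst psi.
Proof.
move=> eqp p; rewrite /subst; congr comp_mpoly.
by apply: eq_from_tnth => i; rewrite !tnth_mktuple.
Qed.

Lemma subst_id p : subst mvar p = p.
Proof. exact: comp_mpoly_id. Qed.

Lemma subst_comp phi psi p :
  subst phi (subst psi p) = subst (fun i => subst phi (psi i)) p.
Proof.
elim/mpoly_ring_ind: p => [c|i p IHp|p q IHp IHq].
- by rewrite !substC.
- by rewrite !rmorphM /= IHp !substV.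
- by rewrite !raddfD /= IHp IHq.
Qed.

Definition inverses phi psi :=
  (forall i, subst phi (psi i) = mvar i) /\ (forall i, subst psi (phi i) = mvar i).

Lemma substK phi psi : (forall i, subst phi (psi i) = mvar i) ->
  forall p, subst phi (subst psi p) = p.
Proof.
by move=> inv p; rewrite subst_comp -[RHS]subst_id; exact: eq_subst.
Qed.

Lemma meval_subst phi v p :
  meval v (subst phi p) = meval (fun i => meval v (phi i)) p.
Proof.
rewrite /subst comp_mpoly_meval; apply: meval_eq => i.
by rewrite tnth_mktuple.
Qed.

Lemma mderiv_mvar i j : mderiv i (mvar j : mpoly n K) = (i == j)%:R.
Proof.
rewrite mderivX mnm1E eq_sym; case: eqVneq => [->|]; last by rewrite scale0r.
rewrite scale1r; have -> : mnm_sub (mnm1 j) (mnm1 j) = mnm0.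
  by apply/mnmP => k; rewrite mnmBE subnn mnm0E.
by rewrite mpolyX0.
Qed.

Lemma mderiv_subst phi i p :
  mderiv i (subst phi p) = \sum_j subst phi (mderiv j p) * mderiv i (phi j).
Proof.
elim/mpoly_ring_ind: p => [c|k p IHp|p q IHp IHq].
- rewrite substC mderivC big1 // => j _.
  by rewrite mderivC raddf0 mul0r.
- rewrite rmorphM /= substV mderivM IHp mulr_sumr.
  under [RHS]eq_bigr => j _.
    rewrite mderivM mderiv_mvar raddfD /= !rmorphM rmorph_nat /= substV mulrDl.
    over.
  rewrite big_split /=; congr (_ + _); last first.
    by apply: eq_bigr => j _; rewrite mulrA.
  rewrite (bigD1 k) //= eqxx mul1r big1 ?addr0 1?mulrC // => j /negPf.
  by rewrite eq_sym eq_sym => ->; rewrite !mul0r.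
- rewrite !raddfD /= IHp IHq -big_split /=; apply: eq_bigr => j _.
  by rewrite !raddfD /= mulrDl.
Qed.

End Subst.

Section Vanishing.
Variables (n : nat) (K : numFieldType).

Lemma poly_vanish_eq0 (q : {poly K}) : (forall y, q.[y] = 0) -> q = 0.
Proof.
move=> q0; apply/eqP/negPn/negP => qn0.
have /(max_poly_roots qn0) : all (root q) [seq k%:R | k <- iota 0 (size q)].
  by apply/allP => y _; rewrite /root q0.
rewrite map_inj_uniq ?iota_uniq ?size_map ?size_iota ?ltnn; first by move/(_ isT).
exact: mulrIn (oner_neq0 _).
Qed.

Lemma digits_inj (B : nat) (s t : nat -> nat) k :
    (forall i, (i < k)%N -> (s i < B)%N /\ (t i < B)%N) ->
    (\sum_(i < k) s i * B ^ i = \sum_(i < k) t i * B ^ i)%N ->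
  forall i, (i < k)%N -> s i = t i.
Proof.
elim: k s t => // k IHk s t lt_B; rewrite !big_ord_recl !expn0 !muln1.
have shift u : (\sum_(i < k) u (bump 0 i) * B ^ bump 0 i
              = B * \sum_(i < k) u i.+1 * B ^ i)%N.
  rewrite big_distrr; apply: eq_bigr => i _.
  by rewrite /bump add1n expnS /= mulnCA.
rewrite (shift s) (shift t) => eq_st.
have [s0 t0] := lt_B 0%N isT.
have B0 : (0 < B)%N by apply: leq_ltn_trans s0.
have eq0 : s 0%N = t 0%N.
  have /(congr1 (modn^~ B)) := eq_st.
  by rewrite ![(_ + B * _)%N]addnC ![(B * _)%N]mulnC !modnMDl !modn_small.
case=> [|i] //; rewrite ltnS => ltik.
apply: (IHk (s \o succn) (t \o succn)) => // [j ltj|]; first exact: lt_B.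
by move: eq_st; rewrite eq0 => /addnI/eqP; rewrite eqn_pmul2l // => /eqP.
Qed.

(** Kronecker substitution: replacing x_i by y ^ (B ^ i), with B larger than all
    exponents, sends distinct monomials of p to distinct powers of y. *)
Lemma mpoly_vanish_eq0 (p : mpoly n K) : (forall v, meval v p = 0) -> p = 0.
Proof.
move=> p0; pose B := (msize p).
pose code (m : multinom n) := (\sum_(i < n) m i * B ^ i)%N.
have code_inj : {in msupp p &, injective code}.
  move=> m1 m2 m1p m2p eqc; apply/mnmP => i.
  have ltB (m : multinom n) j : m \in msupp p -> (m j < B)%N.
    move=> mp; apply: leq_ltn_trans (msize_mdeg_lt mp).
    by rewrite mdegE (bigD1 j) //= leq_addr.
  have n0 : (0 < n)%N by case: (n) i => [[]|].
  pose nt (m : multinom n) k := m (insubd i k).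
  have ntE m (j : 'I_n) : nt m j = m j by rewrite /nt valKd.
  rewrite -!ntE; apply: (@digits_inj B (nt m1) (nt m2) n) => //.
    by move=> k _; split; apply: ltB.
  rewrite /code in eqc.
  by under eq_bigr do rewrite ntE; under [RHS]eq_bigr do rewrite ntE.
pose q : {poly K} := \sum_(m <- msupp p) mcoeff m p *: 'X^(code m).
have q0 : q = 0.
  apply: poly_vanish_eq0 => y; rewrite -[RHS](p0 (fun i => y ^+ (B ^ i)%N)).
  rewrite mevalE /q horner_sum; apply: eq_bigr => m _.
  rewrite hornerZ hornerXn /code; congr (_ * _).
  rewrite -prodrXr; apply: eq_bigr => i _.
  by rewrite -exprM mulnC.
apply/mpolyP => m; rewrite mcoeff0.
have [mp|] := boolP (m \in msupp p); last by rewrite -mcoeff_eq0 => /eqP.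
have := congr1 (fun r : {poly K} => r`_(code m)) q0.
rewrite coef0 /q coef_sum (bigD1_seq m) ?msupp_uniq //=.
rewrite coefZ coefXn eqxx mulr1 big_seq_cond big1 ?addr0 // => k /andP[kp nkm].
rewrite coefZ coefXn; case: eqP => [/code_inj eqk|]; last by rewrite mulr0.
by rewrite eqk ?eqxx // in nkm.
Qed.

End Vanishing.

(** * Weighted degree *)

Section Graded.
Variables (R : realType) (n : nat) (w : 'I_n -> R).
Local Notation C := R[i].
Local Notation A := (mpoly n R[i]).
Local Notation W := (wpart w).
Implicit Types (p q : A) (m : multinom n) (phi psi : 'I_n -> A).

Lemma wdegD m1 m2 : wdeg w (mnm_add m1 m2) = wdeg w m1 + wdeg w m2.
Proof.
rewrite /wdeg -big_split /=; apply: eq_bigr => i _.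
by rewrite mnmDE natrD mulrDr.
Qed.

Lemma wdeg0 : wdeg w mnm0 = 0.
Proof. by rewrite /wdeg big1 // => i _; rewrite mnm0E mulr0. Qed.

Lemma wdeg1 i : wdeg w (mnm1 i) = w i.
Proof.
rewrite /wdeg (bigD1 i) //= mnm1E eqxx mulr1 big1 ?addr0 // => j /negPf.
by rewrite mnm1E eq_sym => ->; rewrite mulr0.
Qed.

Lemma mcoeffM_neq0 p q m : mcoeff m (p * q) != 0 ->
  exists m1 m2, [/\ mcoeff m1 p != 0, mcoeff m2 q != 0 & m = mnm_add m1 m2].
Proof.
rewrite -mcoeff_msupp => /msuppM_le/allpairsP[[m1 m2] /= [m1p m2q ->]].
by exists m1, m2; split; rewrite -?mcoeff_msupp.
Qed.

Lemma wpart0 e : W e 0.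
Proof. by move=> m; rewrite mcoeff0 eqxx. Qed.

Lemma wpartD e p q : W e p -> W e q -> W e (p + q).
Proof.
move=> Wp Wq m; rewrite mcoeffD; have [->|/Wp//] := eqVneq (mcoeff m p) 0.
by rewrite add0r => /Wq.
Qed.

Lemma wpartZ e c p : W e p -> W e (c *: p).
Proof. by move=> Wp m; rewrite mcoeffZ mulf_eq0 => /norP[_ /Wp]. Qed.

Lemma wpartN e p : W e p -> W e (- p).
Proof. by move=> Wp; rewrite -scaleN1r; exact: wpartZ. Qed.

Lemma wpartB e p q : W e p -> W e q -> W e (p - q).
Proof. by move=> Wp Wq; apply: wpartD => //; exact: wpartN. Qed.

Lemma wpart_sum (I : Type) (r : seq I) (P : pred I) (F : I -> A) e :
  (forall i, P i -> W e (F i)) -> W e (\sum_(i <- r | P i) F i).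
Proof.
by move=> WF; apply: (big_ind (W e)) => //; [exact: wpart0|exact: wpartD].
Qed.

Lemma wpartX m : W (wdeg w m) (mpolyX _ m).
Proof.
by move=> m'; rewrite mcoeffX; case: (eqVneq m m') => [->|] // _; rewrite eqxx.
Qed.

Arguments wpartX : clear implicits.

Lemma wpartV i : W (w i) (mvar i).
Proof. by rewrite -wdeg1; exact: wpartX. Qed.

Lemma wpartC c : W 0 (mpolyC n c).
Proof.
move=> m; rewrite mcoeffC; case: (eqVneq m mnm0) => [-> _|_]; first exact: wdeg0.
by rewrite mulr0 eqxx.
Qed.

Lemma wpart1 : W 0 1.
Proof. by rewrite -mpolyC1; exact: wpartC. Qed.

Lemma wpartM a b p q : W a p -> W b q -> W (a + b) (p * q).
Proof.
by move=> Wp Wq m /mcoeffM_neq0[m1 [m2 [/Wp <- /Wq <- ->]]]; rewrite wdegD.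
Qed.

Lemma wpartX_prod phi m :
  (forall i, W (w i) (phi i)) -> W (wdeg w m) (\prod_i phi i ^+ m i).
Proof.
move=> Wphi; apply: (big_rec2 W); first exact: wpart1.
move=> i e p _ Wp; apply: wpartM => //.
elim: (m i) => [|k IHk]; first by rewrite mulr0 expr0; exact: wpart1.
by rewrite exprS -add1n natrD mulrDr mulr1; exact: wpartM.
Qed.

Lemma wpart_subst phi e p :
  (forall i, W (w i) (phi i)) -> W e p -> W e (subst phi p).
Proof.
move=> Wphi Wp; rewrite [p]mpolyE raddf_sum big_seq /=.
apply: wpart_sum => m; rewrite mcoeff_msupp => /Wp <-.
by rewrite linearZ /= substX; apply: wpartZ; exact: wpartX_prod.
Qed.

Lemma wpart_mderiv i e p : W e p -> W (e - w i) (mderiv i p).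
Proof.
move=> Wp m; rewrite mcoeff_deriv mulrn_eq0 => /norP[_ /Wp <-].
by rewrite wdegD wdeg1 addrK.
Qed.

Lemma euler e p : W e p -> e%:C%C *: p = \sum_i (w i)%:C%C *: (mvar i * mderiv i p).
Proof.
move=> Wp; rewrite [p in LHS]mpolyE scaler_sumr.
transitivity (\sum_i \sum_(m <- msupp p)
    (w i)%:C%C *: (mvar i * mderiv i (mcoeff m p *: mpolyX C m))); last first.
  apply: eq_bigr => i _; rewrite -scaler_sumr -mulr_sumr -raddf_sum.
  by rewrite -mpolyE.
rewrite exchange_big /= big_seq [RHS]big_seq; apply: eq_bigr => m.
rewrite mcoeff_msupp => /Wp <-.
rewrite /wdeg raddf_sum scaler_suml; apply: eq_bigr => i _.
rewrite mderivZ mderivX scalerA -!scalerAr !scalerA.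
rewrite -mpolyXD; have [mi0|mi0] := posnP (m i).
  by rewrite mi0 !mulr0 raddf0 mul0r !scale0r.
have -> : mnm_add (mnm1 i) (mnm_sub m (mnm1 i)) = m.
  apply/mnmP => j; rewrite mnmDE mnmBE mnm1E addnC subnK //.
  by case: eqP => // <-.
by congr (_ *: _); rewrite /= rmorphM rmorph_nat; ring.
Qed.

Section Component.
Variable e : R.

Definition wcomp p : A :=
  \sum_(m <- msupp p | wdeg w m == e) mcoeff m p *: mpolyX _ m.

Lemma mcoeff_wcomp m p :
  mcoeff m (wcomp p) = if wdeg w m == e then mcoeff m p else 0.
Proof.
rewrite raddf_sum /=; have [mp|mp] := boolP (m \in msupp p); last first.
  move: (mp); rewrite -mcoeff_eq0 => /eqP ->; rewrite if_same big_seq_cond big1 //.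
  move=> k /andP[kp _]; rewrite mcoeffZ mcoeffX; case: eqP => [km|].
    by rewrite -km kp in mp.
  by rewrite mulr0.
rewrite big_mkcond (bigD1_seq m) ?msupp_uniq //= big1 ?addr0 => [|k /negPf nkm].
  by case: ifP => //; rewrite mcoeffZ mcoeffX eqxx mulr1.
by rewrite mcoeffZ mcoeffX nkm mulr0 if_same.
Qed.

Lemma wpart_wcomp p : W e (wcomp p).
Proof. by move=> m; rewrite mcoeff_wcomp; case: ifP => [/eqP|]; rewrite ?eqxx. Qed.

Lemma wcomp_id p : W e p -> wcomp p = p.
Proof.
move=> Wp; apply/mpolyP => m; rewrite mcoeff_wcomp.
by case: ifPn => // /eqP Hm; case: (eqVneq (mcoeff m p) 0) => // /Wp.
Qed.

Fact wcomp_is_linear : linear wcomp.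
Proof.
move=> c p q; apply/mpolyP => m; rewrite mcoeffD mcoeffZ !mcoeff_wcomp.
by case: ifP => _; rewrite ?mcoeffD ?mcoeffZ // mulr0 addr0.
Qed.
HB.instance Definition _ := GRing.isLinear.Build C A A _ wcomp wcomp_is_linear.

Lemma wcompX m : wcomp (mpolyX _ m) = if wdeg w m == e then mpolyX _ m else 0.
Proof.
case: eqP => [ee|ne]; first by rewrite wcomp_id // -ee; exact: wpartX.
apply/mpolyP => k; rewrite mcoeff_wcomp mcoeffX mcoeff0.
by case: eqP => // ke; case: eqP => // mk; rewrite mk ke in ne.
Qed.

Lemma wcomp_wpart e' p : W e' p -> wcomp p = if e' == e then p else 0.
Proof.
move=> Wp; case: eqP => [ee|ne]; first by rewrite wcomp_id // -ee.
apply/mpolyP => m; rewrite mcoeff_wcomp mcoeff0; case: eqP => // me.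
by have [//|/Wp em] := eqVneq (mcoeff m p) 0; rewrite -em me in ne.
Qed.

End Component.

(** Hence the coefficients that express a homogeneous polynomial through
    homogeneous generators of an ideal may be taken homogeneous. *)
Lemma wcompMr e b p q : W b q -> wcomp e (p * q) = wcomp (e - b) p * q.
Proof.
move=> Wq; rewrite [p]mpolyE mulr_suml !raddf_sum mulr_suml /=.
apply: eq_bigr => m _; rewrite -scalerAl !linearZ -scalerAl /=; congr (_ *: _).
rewrite wcompX (wcomp_wpart _ (wpartM (wpartX m) Wq)) eq_sym -subr_eq eq_sym.
by case: ifP; rewrite ?mul0r.
Qed.

Lemma wcomp_subst e phi p : (forall i, W (w i) (phi i)) ->
  wcomp e (subst phi p) = subst phi (wcomp e p).
Proof.
move=> Wphi.
apply: (@eq_linear_mpoly _ _ _ (wcomp e \o subst phi) (subst phi \o wcomp e)).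
move=> m /=.
rewrite wcompX (wcomp_wpart _ (wpart_subst Wphi (wpartX m))).
by case: ifP; rewrite ?raddf0.
Qed.

Hypothesis hw : forall i, 0 < w i.

Lemma wdeg_ge0 m : 0 <= wdeg w m.
Proof. by apply: sumr_ge0 => i _; rewrite mulr_ge0 // ltW. Qed.

Lemma wdeg_ge m i : w i * (m i)%:R <= wdeg w m.
Proof.
rewrite /wdeg (bigD1 i) //= lerDl; apply: sumr_ge0 => j _.
by rewrite mulr_ge0 // ltW.
Qed.

Lemma wdeg_eq0 m : wdeg w m = 0 -> m = mnm0.
Proof.
move=> m0; apply/mnmP => i; rewrite mnm0E; have := wdeg_ge m i.
rewrite m0; case: (m i) => // k; by rewrite leNgt mulr_gt0 // ltr0n.
Qed.

Lemma wpart0_const p : W 0 p -> p = mpolyC n (mcoeff mnm0 p).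
Proof.
move=> Wp; apply/mpolyP => m; rewrite mcoeffC.
case: (eqVneq m mnm0) => [->|mn0]; first by rewrite mulr1.
rewrite mulr0; have [//|/Wp/wdeg_eq0 E] := eqVneq (mcoeff m p) 0.
by rewrite E eqxx in mn0.
Qed.

Lemma wpart_nonpos e p : e < 0 -> W e p -> p = 0.
Proof.
move=> e0 Wp; apply/mpolyP => m; rewrite mcoeff0.
have [//|/Wp E] := eqVneq (mcoeff m p) 0.
by have := wdeg_ge0 m; rewrite E leNgt e0.
Qed.

Lemma mcoeff0_wpart e p : 0 < e -> W e p -> mcoeff mnm0 p = 0.
Proof.
move=> e0 Wp; have [//|/Wp E] := eqVneq (mcoeff mnm0 p) 0.
by move: e0; rewrite -E wdeg0 ltxx.
Qed.

End Graded.
Arguments wpart_mderiv {R n w} i {e p}.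
Arguments wpartV {R n} w i.

(** Scaling by t = 2 multiplies the coefficient of a monomial m by 2 ^ wdeg m; as
    a polynomial is determined by its values, comparison with 2 ^ d forces
    wdeg m = d on the support. *)
Lemma weighted_homogeneous_wpart (R : realType) (n : nat) (w : 'I_n -> R) (d : R)
  (f : mpoly n R[i]) : weighted_homogeneous w d f -> wpart w d f.
Proof.
move=> hf m; pose c (k : multinom n) : R := \prod_i (2 `^ w i) ^+ k i.
have cE k : c k = 2 `^ (wdeg w k).
  have p2 : (0:R) <= 2 by [].
  rewrite /c /wdeg; elim/big_ind2: _ => [|a x b y -> ->|i _]; first by rewrite powRr0.
    by rewrite powRD // (_ : (2 : R) == 0 = false) ?implybT //; apply/negbTE/eqP; lra.
  by rewrite powRrM powR_mulrn ?powR_ge0.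
pose g : mpoly n R[i] := \sum_(k <- msupp f) ((c k)%:C%C * mcoeff k f) *: mpolyX _ k.
have gE : g = (2 `^ d)%:C%C *: f.
  apply/eqP; rewrite -subr_eq0; apply/eqP/mpoly_vanish_eq0 => v.
  rewrite mevalB mevalZ -(hf 2 v) //; apply/eqP; rewrite subr_eq0; apply/eqP.
  rewrite /g raddf_sum /= mevalE; apply: eq_bigr => k _.
  rewrite mevalZ mevalX /c rmorph_prod mulrC mulrA [LHS]mulrC; congr (_ * _).
  rewrite -big_split /=; apply: eq_bigr => i _.
  by rewrite exprMn rmorphXn /= mulrC.
move=> mf; have mcg : mcoeff m g = (c m)%:C%C * mcoeff m f.
  rewrite /g raddf_sum (bigD1_seq m) ?msupp_uniq ?mcoeff_msupp //=.
  rewrite mcoeffZ mcoeffX eqxx mulr1 big1 ?addr0 // => k /negPf km.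
  by rewrite mcoeffZ mcoeffX km mulr0.
move: mcg; rewrite gE mcoeffZ => /(mulIf mf)/(@complexI _) /esym.
rewrite cE => /(congr1 (@ln R)); rewrite !ln_powR => /mulIf; apply.
by rewrite gt_eqF // ln_gt0 //; lra.
Qed.

(** * Completing a graded matrix to an invertible one *)

Lemma unitmx_inj (K : fieldType) (n : nat) (M : 'M[K]_n) :
  (forall v : 'rV_n, v *m M = 0 -> v = 0) -> M \in unitmx.
Proof.
move=> inj; rewrite -row_free_unit -kermx_eq0; apply/eqP/row_matrixP => i.
by rewrite row0; apply: inj; rewrite -row_mul mulmx_ker row0.
Qed.

(** Fields have stable rank 1. The kernel of M has the same dimension as the
    complement H :\: M of the row space of M, so U *m H can be chosen to map this
    kernel isomorphically onto that complement. *)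
Lemma unitmx_complete (K : fieldType) (n : nat) (M H : 'M[K]_n) :
  row_full (M + H)%MS -> exists U, M + U *m H \in unitmx.
Proof.
move=> full; pose c := row_base (H :\: M)%MS; pose k := row_base (kermx M).
have eq_rank : \rank (H :\: M)%MS = \rank (kermx M).
  have := mxrank_sum_cap M H; rewrite capmxC (eqP full).
  have := mxrank_cap_compl H M; have := rank_leq_row M; rewrite mxrank_ker.
  by lia.
have /row_freeP[X kX] : row_free k by exact: row_base_free.
pose T : 'M[K]_n := X *m castmx (eq_rank, erefl n) c.
have cH : (castmx (eq_rank, erefl n) c <= H :\: M)%MS.
  by rewrite (eqmx_cast _ _) eq_row_base.
have fc : row_free (castmx (eq_rank, erefl n) c).
  by rewrite /row_free (eqmx_cast _ _) -eq_rank eq_row_base.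
have /submxP[U TU] : (T <= H)%MS.
  by apply: submx_trans (diffmxSl H M); exact: mulmx_sub.
exists U; rewrite -TU; apply: unitmx_inj => v; rewrite mulmxDr => /eqP.
rewrite addr_eq0 => /eqP vMT.
have vM0 : v *m M = 0.
  apply/eqP; rewrite -submx0 -(capmx_diff H M) sub_capmx submxMl andbT.
  by rewrite vMT eqmx_opp mulmx_sub // mulmx_sub.
have vX0 : v *m X = 0.
  apply: (row_free_inj fc); rewrite mul0mx -mulmxA -/T.
  by apply/eqP; rewrite -oppr_eq0 -vMT vM0.
have /submxP[y vy] : (v <= k)%MS by rewrite eq_row_base; apply/sub_kermxP.
by rewrite vy -[y]mulmx1 -kX mulmxA -vy vX0 mul0mx.
Qed.

Section BlockCompletion.
Variables (K : fieldType) (n : nat).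
Implicit Types (L S H : 'M[K]_n).

Lemma diag_mx_comm (a b : 'rV[K]_n) (B : 'M[K]_n) :
  (forall i j, B i j != 0 -> a 0 i = b 0 j) -> diag_mx a *m B = B *m diag_mx b.
Proof.
move=> blk; apply/matrixP => i j; rewrite mul_diag_mx mul_mx_diag !mxE mulrC.
by have [->|/blk ->//] := eqVneq (B i j) 0; rewrite !mul0r.
Qed.

(** A matrix is block diagonal when it commutes with the projections on the
    blocks, and then so does its inverse. *)
Lemma invmx_block (T : eqType) (a : 'I_n -> T) L : L \in unitmx ->
    (forall i j, L i j != 0 -> a i = a j) ->
  forall i j, invmx L i j != 0 -> a i = a j.
Proof.
move=> uL bL i j nz; pose P : 'M[K]_n := diag_mx (\row_k (a k == a i)%:R).
have PL : P *m L = L *m P by apply: diag_mx_comm => k l /bL; rewrite !mxE => ->.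
have PV : invmx L *m P = P *m invmx L.
  rewrite -[LHS]mulmx1 -(mulmxV uL) mulmxA -(mulmxA _ P) PL mulmxA.
  by rewrite (mulVmx uL) mul1mx.
move/matrixP/(_ i j): PV; rewrite mul_diag_mx mul_mx_diag !mxE eqxx mul1r.
case: (a j =P a i) => [-> //|_]; rewrite mulr0 => V0.
by rewrite -V0 eqxx in nz.
Qed.

(** Graded form of [unitmx_complete]. The completion is performed separately
    in each block of coordinates carrying the same label, on the matrix that
    agrees with L on this block and is the identity elsewhere. The labels a
    will be the weights, and b i the degree of the i-th partial derivative. *)
Lemma block_complete (T : eqType) (a b : 'I_n -> T) L S H :
    (forall i j, L i j != 0 -> a i = a j) ->
    (forall i j, H i j != 0 -> b i = a j) ->
    (S *m L - 1%:M <= H)%MS ->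
  exists Y : 'M[K]_n, (forall i j, Y i j != 0 -> a i = b j) /\
    L + Y *m H \in unitmx.
Proof.
move=> bL bH /submxP[Z SL].
pose P e : 'M[K]_n := diag_mx (\row_i (a i == e)%:R).
pose Q e : 'M[K]_n := diag_mx (\row_i (b i == e)%:R).
have PL e : P e *m L = L *m P e by apply: diag_mx_comm => i j /bL; rewrite !mxE => ->.
have QH e : Q e *m H = H *m P e by apply: diag_mx_comm => i j /bH; rewrite !mxE => ->.
have PP e : P e *m P e = P e.
  apply/matrixP => i j; rewrite mul_diag_mx !mxE.
  by case: (a i == e); rewrite ?mul1r // mul0r mul0rn.
pose M e := P e *m L + (1%:M - P e).
have PM e : P e *m M e = P e *m L.
  by rewrite mulmxDr mulmxA PP mulmxBr mulmx1 PP subrr addr0.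
have /choice[U HU] : forall e, exists U, M e + U *m (Q e *m H) \in unitmx.
  move=> e; apply: unitmx_complete.
  have E : 1%:M = (1%:M - P e + S *m P e) *m M e - Z *m (Q e *m H).
    have -> : Z *m (Q e *m H) = S *m L *m P e - P e.
      by rewrite QH mulmxA -SL mulmxBl mul1mx.
    have -> : (1%:M - P e + S *m P e) *m M e = 1%:M - P e + S *m L *m P e.
      rewrite mulmxDl -[S *m P e *m _]mulmxA PM PL mulmxA; congr (_ + _).
      rewrite mulmxDr mulmxA !mulmxBl !mul1mx !mulmxBr !mulmx1 PP.
      by rewrite !subrr subr0 add0r.
    by rewrite addrKA opprK subrK.
  rewrite -sub1mx E; apply: addmx_sub_adds; first exact: submxMl.
  by rewrite eqmx_opp; exact: submxMl.
pose Y : 'M[K]_n := \matrix_(i, j) ((U (a i) i j) *+ (a i == b j)).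
have PY e : P e *m Y = P e *m U e *m Q e.
  apply/matrixP => i j; rewrite mul_diag_mx mul_mx_diag mul_diag_mx !mxE.
  by case: (a i =P e) => [->|]; rewrite ?mul0r // !mul1r eq_sym -mulr_natr.
exists Y; split=> [i j|].
  by rewrite !mxE; case: (a i =P b j) => // _; rewrite mulr0n eqxx.
apply: unitmx_inj => v v0; apply/rowP => i; rewrite mxE.
set N := L + Y *m H in v0 *.
have bN j k : N j k != 0 -> a j = a k.
  apply: contra_neq_eq => ajk; rewrite !mxE.
  have [->|/bL ajk'] := eqVneq (L j k) 0; last by rewrite ajk' eqxx in ajk.
  rewrite add0r big1 // => l _; rewrite mxE.
  case: (a j =P b l) => [ajl|_]; last by rewrite mulr0n mul0r.
  have [->|/bH bl] := eqVneq (H l k) 0; first by rewrite mulr0.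
  by rewrite ajl bl eqxx in ajk.
have PN : P (a i) *m N = N *m P (a i).
  by apply: diag_mx_comm => j k /bN; rewrite !mxE => ->.
have vP : v *m P (a i) = 0.
  rewrite -[LHS](mulmxK (HU (a i))); set B := _ + _.
  suff -> : v *m P (a i) *m B = 0 by rewrite mul0mx.
  have -> : v *m P (a i) *m B = v *m (P (a i) *m N).
    rewrite -mulmxA; congr (v *m _).
    by rewrite [LHS]mulmxDr PM [RHS]mulmxDr !mulmxA PY.
  by rewrite PN mulmxA v0 mul0mx.
have := congr1 (fun u : 'rV_n => u 0 i) vP.
by rewrite mul_mx_diag !mxE eqxx mulr1.
Qed.

End BlockCompletion.

(** * Graded automorphisms *)

Section JacobianAtOrigin.
Variables (n : nat) (K : comNzRingType).
Implicit Types (phi psi : 'I_n -> mpoly n K) (p : mpoly n K).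

Lemma meval0E p : meval (fun=> 0) p = mcoeff mnm0 p.
Proof.
elim/mpoly_ring_ind: p => [c|i p _|p q IHp IHq].
- by rewrite mevalC mpolyCK.
- rewrite mevalM mevalXU mul0r; apply/esym/eqP; apply/negPn/negP.
  rewrite -mcoeff_msupp => /msuppM_le/allpairsP[[m1 m2] /= [+ _ /esym/eqP]].
  by rewrite mnmD_eq0 => /mem_msuppXP <- /andP[]; rewrite mnm1_eq0.
- by rewrite mevalD mcoeffD IHp IHq.
Qed.

Definition jac0 phi : 'M[K]_n :=
  \matrix_(i, j) meval (fun=> 0) (mderiv j (phi i)).

Lemma jac0E phi i j : jac0 phi i j = mcoeff (mnm1 j) (phi i).
Proof.
rewrite mxE meval0E mcoeff_deriv mnm0E mulr1n; congr mcoeff.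
by apply/mnmP => k; rewrite mnmDE mnm0E.
Qed.

Lemma jac0_id : jac0 mvar = 1%:M.
Proof.
by apply/matrixP => i j; rewrite !mxE mderiv_mvar eq_sym rmorph_nat.
Qed.

Lemma jac0_comp phi psi : (forall i, meval (fun=> 0) (phi i) = 0) ->
  jac0 (fun i => subst phi (psi i)) = jac0 psi *m jac0 phi.
Proof.
move=> phi0; apply/matrixP => i j; rewrite !mxE mderiv_subst raddf_sum.
apply: eq_bigr => k _; rewrite /= mevalM meval_subst !mxE; congr (_ * _).
exact: meval_eq.
Qed.

End JacobianAtOrigin.

Section GradedEndomorphisms.
Variables (R : realType) (n : nat) (w : 'I_n -> R).
Local Notation C := R[i].
Local Notation A := (mpoly n R[i]).
Local Notation W := (wpart w).
Implicit Types (p q : A) (m : multinom n) (phi psi : 'I_n -> A).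

Definition graded phi := forall i, W (w i) (phi i).

Lemma graded_var : graded mvar.
Proof. by move=> i; exact: wpartV. Qed.

Lemma graded_comp phi psi :
  graded phi -> graded psi -> graded (fun i => subst phi (psi i)).
Proof. by move=> gphi gpsi i; apply: wpart_subst. Qed.

Hypothesis hw : forall i, 0 < w i.

Lemma graded_meval0 phi : graded phi -> forall i, meval (fun=> 0) (phi i) = 0.
Proof. by move=> gphi i; rewrite meval0E; apply: mcoeff0_wpart (gphi i). Qed.

Lemma jac0_block phi i j : graded phi -> jac0 phi i j != 0 -> w i = w j.
Proof. by move=> gphi; rewrite jac0E => /gphi; rewrite wdeg1. Qed.

Lemma wdeg_gt m i : (0 < m i)%N -> m != mnm1 i -> w i < wdeg w m.
Proof.
move=> mi nm; have mE : m = mnm_add (mnm_sub m (mnm1 i)) (mnm1 i).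
  apply/mnmP => k; rewrite mnmDE mnmBE subnK // mnm1E.
  by case: eqP => // <-.
rewrite mE wdegD wdeg1 ltrDr lt_neqAle wdeg_ge0 // andbT eq_sym.
apply: contra_neq nm => /(wdeg_eq0 hw) E.
by rewrite mE E; apply/mnmP => k; rewrite mnmDE mnm0E.
Qed.

(** By weight, phi_i is the sum of a linear form in variables of weight w_i
    and of monomials in variables of smaller weight. By induction the latter are
    in the image of the substitution, so the linear forms are too, and the
    inverse of the linear part recovers the variables. *)
Lemma mvar_preimage phi : graded phi -> jac0 phi \in unitmx ->
  forall j, exists p, subst phi p = mvar j.
Proof.
move=> gphi uL j.
pose Im q := exists p, subst phi p = q.
have ImD p q : Im p -> Im q -> Im (p + q).
  by move=> [a <-] [b <-]; exists (a + b); rewrite raddfD.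
have ImM p q : Im p -> Im q -> Im (p * q).
  by move=> [a <-] [b <-]; exists (a * b); rewrite rmorphM.
have ImC c : Im (mpolyC n c) by exists (mpolyC n c); rewrite substC.
have ImZ c p : Im p -> Im (c *: p) by move=> Ip; rewrite -mul_mpolyC; exact: ImM.
have Im0 : Im 0 by exists 0; rewrite raddf0.
have ImX m : (forall i, (0 < m i)%N -> Im (mvar i)) -> Im (mpolyX _ m).
  move=> Im_m; rewrite mpolyXE_id; apply: (big_ind Im) => // [|i _].
    by rewrite -mpolyC1; exact: ImC.
  have [->|/Im_m Ii] := posnP (m i); first by rewrite expr0 -mpolyC1; exact: ImC.
  elim: (m i) => [|k IHk]; first by rewrite expr0 -mpolyC1; exact: ImC.
  by rewrite exprS; exact: ImM.
rewrite -/(Im _).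
(* Induction on the number of variables of smaller weight. *)
have [N] := ubnP #|[pred i | w i < w j]|; elim: N j => // N IHN j.
rewrite ltnS => ltN.
have Im_lt i : w i < w j -> Im (mvar i).
  move=> wij; apply: IHN; apply: leq_trans ltN; apply: proper_card.
  apply/properP; split; last by exists i; rewrite !inE ?ltxx.
  by apply/fintype.subsetP => k; rewrite !inE => /lt_trans; apply.
pose L := jac0 phi.
have ImL i : w i = w j -> Im (\sum_k L i k *: mvar k).
  move=> wij; set l := \sum_k _.
  have lU k : mcoeff (mnm1 k) l = L i k.
    rewrite raddf_sum (bigD1 k) //= mcoeffZ mcoeffX eqxx mulr1.
    rewrite big1 ?addr0 // => h nhk; rewrite mcoeffZ mcoeffX.
    case: eqP => [/mnmP/(_ k)|]; last by rewrite mulr0.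
    by rewrite !mnm1E eqxx (negPf nhk).
  have Wl : W (w i) l.
    apply: wpart_sum => k _.
    have [->|/(jac0_block gphi) ->] := eqVneq (L i k) 0.
      by rewrite scale0r; exact: wpart0.
    by apply: wpartZ; exact: wpartV.
  rewrite -(subKr (phi i) l); apply: (ImD); first by exists (mvar i); rewrite substV.
  rewrite -scaleN1r; apply: (ImZ); rewrite [_ - _]mpolyE big_seq.
  apply: (big_ind Im) => // m; rewrite mcoeff_msupp => mr.
  apply: (ImZ); apply: (ImX) => k mk; apply: Im_lt.
  rewrite -wij -(wpartB (gphi i) Wl mr); apply: wdeg_gt => //.
  by apply: contraNneq mr => ->; rewrite mcoeffB lU -jac0E subrr.
have -> : mvar j = \sum_i invmx L j i *: \sum_k L i k *: mvar k :> A.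
  under eq_bigr do rewrite scaler_sumr.
  rewrite exchange_big /= (bigD1 j) //= [X in X + _](_ : _ = mvar j).
    rewrite big1 ?addr0 // => k kj.
    under eq_bigr do rewrite scalerA.
    rewrite -scaler_suml (_ : \sum_i _ = (invmx L *m L) j k); last by rewrite !mxE.
    by rewrite mulVmx // mxE eq_sym (negPf kj) scale0r.
  under eq_bigr do rewrite scalerA.
  rewrite -scaler_suml (_ : \sum_i _ = (invmx L *m L) j j); last by rewrite !mxE.
  by rewrite mulVmx // mxE eqxx scale1r.
apply: (big_ind Im) => // i _.
have [->|nz] := eqVneq (invmx L j i) 0; first by rewrite scale0r.
apply: (ImZ); apply: (ImL); apply/esym.
by apply: invmx_block nz => // a b; exact: jac0_block.
Qed.

Lemma graded_preimage phi : graded phi -> jac0 phi \in unitmx ->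
  exists psi, graded psi /\ forall i, subst phi (psi i) = mvar i.
Proof.
move=> gphi uL.
have [p Hp] := choice (mvar_preimage gphi uL).
exists (fun i => wcomp w (w i) (p i)); split; first by move=> i; exact: wpart_wcomp.
by move=> i; rewrite -wcomp_subst // Hp wcomp_id //; exact: wpartV.
Qed.

(** The right inverse psi of phi has an invertible linear part too, hence a
    right inverse of its own, which can only be phi. *)
Theorem graded_inverse phi : graded phi -> jac0 phi \in unitmx ->
  exists2 psi, graded psi & inverses phi psi.
Proof.
move=> gphi uL; have [psi [gpsi inv]] := graded_preimage gphi uL.
have upsi : jac0 psi \in unitmx.
  have jM : jac0 psi *m jac0 phi = 1%:M.
    rewrite -jac0_comp; last exact: graded_meval0.
    rewrite -jac0_id; apply/matrixP => i j.
    by rewrite [LHS]mxE [RHS]mxE inv.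
  exact: (proj1 (mulmx1_unit jM)).
have [chi [_ inv']] := graded_preimage gpsi upsi.
exists psi; first exact: gpsi.
split=> [|i]; first exact: inv.
have -> : phi i = chi i by rewrite -(substV phi i) -(inv' i) (substK inv).
exact: inv'.
Qed.

End GradedEndomorphisms.

(** * Graded equivalence and its geometric meaning *)

Section JacobianIdealSubst.
Variables (n : nat) (K : fieldType).
Implicit Types (f g h p q : mpoly n K) (phi psi : 'I_n -> mpoly n K).

Lemma jacobian_ideal_mderiv f i : mderiv i f \in jacobian_ideal f.
Proof.
apply/jacobian_idealP; exists (fun j => (i == j)%:R).
rewrite (bigD1 i) //= eqxx mul1r big1 ?addr0 // => j /negPf.
by rewrite eq_sym => ->; rewrite mul0r.
Qed.

Lemma jacobian_idealMr f p q : p \in jacobian_ideal f -> p * q \in jacobian_ideal f.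
Proof. by rewrite mulrC; exact: jacobian_idealMl. Qed.

Lemma jacobian_idealZ f c p : p \in jacobian_ideal f -> c *: p \in jacobian_ideal f.
Proof. by rewrite -mul_mpolyC; exact: jacobian_idealMl. Qed.

Lemma jacobian_ideal_subst phi f h :
    (forall j, subst phi (mderiv j f) \in jacobian_ideal h) ->
  forall p, p \in jacobian_ideal f -> subst phi p \in jacobian_ideal h.
Proof.
move=> fh p /jacobian_idealP[c ->]; rewrite subst_sum; apply: rpred_sum => i _.
by rewrite substM; apply: jacobian_idealMl; exact: fh.
Qed.

Lemma mderiv_subst_ideal phi f h :
    (forall j, subst phi (mderiv j f) \in jacobian_ideal h) ->
  forall i, mderiv i (subst phi f) \in jacobian_ideal h.
Proof.
move=> fh i; rewrite mderiv_subst; apply: rpred_sum => j _.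
by apply: jacobian_idealMr; exact: fh.
Qed.

(** Chain rule: f is psi applied to f o phi, so the derivatives of f are
    combinations of pull-backs by psi of derivatives of f o phi. *)
Lemma jacobian_ideal_aut phi psi f : (forall i, subst phi (psi i) = mvar i) ->
    (forall i, subst psi (phi i) = mvar i) ->
  forall p, p \in jacobian_ideal f -> subst phi p \in jacobian_ideal (subst phi f).
Proof.
move=> inv inv'; apply: jacobian_ideal_subst => j.
rewrite -[f in mderiv _ f](substK inv') mderiv_subst subst_sum.
apply: rpred_sum => i _; rewrite substM (substK inv).
by apply: jacobian_idealMr; exact: jacobian_ideal_mderiv.
Qed.

End JacobianIdealSubst.

Section GradedEquivalence.
Variables (R : realType) (n : nat) (w : 'I_n -> R).
Local Notation A := (mpoly n R[i]).
Implicit Types (f g h : A) (phi psi : 'I_n -> A).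

(** Both directions are recorded, so that symmetry costs nothing and the maps
    induced on the affine space are visibly biholomorphic. *)
Definition graded_equiv f g := exists phi psi : 'I_n -> A,
  [/\ graded w phi, graded w psi, inverses phi psi & subst phi f = g].

Lemma graded_equiv_refl f : graded_equiv f f.
Proof.
exists mvar, mvar; split; [exact: graded_var|exact: graded_var| |exact: subst_id].
by split=> i; exact: subst_id.
Qed.

Lemma graded_equiv_sym f g : graded_equiv f g -> graded_equiv g f.
Proof.
move=> [phi [psi [gphi gpsi [inv inv'] <-]]]; exists psi, phi.
by split; [| |split|exact: substK].
Qed.

Lemma graded_equiv_trans f g h :
  graded_equiv f g -> graded_equiv g h -> graded_equiv f h.
Proof.
move=> [phi [psi [gphi gpsi [inv1 inv1'] <-]]] [chi [xi [gchi gxi [inv2 inv2'] <-]]].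
exists (fun i => subst chi (phi i)), (fun i => subst psi (xi i)).
split; [exact: graded_comp|exact: graded_comp| |by rewrite subst_comp].
split=> i.
  by rewrite -(subst_comp chi phi) (substK inv1); exact: inv2.
by rewrite -(subst_comp psi xi) (substK inv2'); exact: inv1'.
Qed.

End GradedEquivalence.

Section PolynomialMaps.
Variables (n : nat) (K : numFieldType).
Implicit Types (phi psi : 'I_n -> mpoly n K).

Lemma meval_differentiable (p : mpoly n K) (z : 'rV[K]_n) :
  differentiable (fun y : 'rV[K]_n => meval (y ord0) p) z.
Proof.
elim/mpoly_ring_ind: p => [c|i p IHp|p q IHp IHq].
- have -> : (fun y : 'rV[K]_n => meval (y ord0) (mpolyC n c)) = cst c.
    by apply/funext => y; rewrite mevalC.
  exact: differentiable_cst.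
- have -> : (fun y : 'rV[K]_n => meval (y ord0) (mvar i * p)) =
            (fun y : 'rV[K]_n => y ord0 i) * (fun y => meval (y ord0) p).
    by apply/funext => y; rewrite mevalM mevalXU.
  by apply: differentiableM => //; exact: differentiable_coord.
- have -> : (fun y : 'rV[K]_n => meval (y ord0) (p + q)) =
            (fun y => meval (y ord0) p) + (fun y => meval (y ord0) q).
    by apply/funext => y; rewrite mevalD.
  exact: differentiableD.
Qed.

Definition polymap phi (z : 'rV[K]_n) : 'rV[K]_n :=
  \row_i meval (z ord0) (phi i).

Lemma polymap_differentiable phi z : differentiable (polymap phi) z.
Proof.
have -> : polymap phi =
    \sum_i (fun y : 'rV[K]_n => meval (y ord0) (phi i) *: (delta_mx ord0 i : 'rV[K]_n)).
  apply/funext => y; rewrite fct_sumE [LHS]row_sum_delta.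
  by apply: eq_bigr => i _; rewrite mxE.
apply: differentiable_sum => i; apply: differentiableZl.
exact: meval_differentiable.
Qed.

Lemma polymapK phi psi :
  (forall i, subst phi (psi i) = mvar i) -> cancel (polymap phi) (polymap psi).
Proof.
move=> inv z; apply/rowP => i; rewrite mxE.
rewrite -[RHS](mevalXU (z ord0) i) -/(mvar i) -inv meval_subst.
by apply: meval_eq => j; rewrite mxE.
Qed.

End PolynomialMaps.

Lemma graded_equiv_right (R : realType) (n : nat) (w : 'I_n -> R)
    (f g : mpoly n R[i]) :
  graded_equiv w f g -> right_equivalent f g.
Proof.
move=> [phi [psi [_ _ [inv inv'] <-]]]; exists (polymap phi).
  split; first by move=> z; exact: polymap_differentiable.
  exists (polymap psi); split; first by move=> z; exact: polymap_differentiable.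
    exact: (polymapK inv).
  exact: (polymapK inv').
move=> z; rewrite meval_subst; apply: meval_eq => i.
by rewrite mxE.
Qed.

(** * Lifting an isomorphism of Milnor algebras *)

Section MilnorMorphism.
Variables (n : nat) (K : fieldType) (f g : mpoly n K).

Lemma jacobian_ideal_pi p : milnor_pi f p = 0 <-> p \in jacobian_ideal f.
Proof. by rewrite -(raddf0 (milnor_pi f)) milnor_piE subr0. Qed.

Lemma milnor_piC c : milnor_pi f (mpolyC n c) = c *: milnor_pi f 1.
Proof. by rewrite -milnor_pi_is_scalable -mul_mpolyC mulr1. Qed.

End MilnorMorphism.

Section MilnorMorphismSubst.
Variables (n : nat) (K : fieldType) (f g : mpoly n K).
Variables (theta : {rmorphism milnor f -> milnor g}) (phi : 'I_n -> mpoly n K).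
Hypothesis thetaZ : scalable theta.
Hypothesis Hphi : forall i, milnor_pi g (phi i) = theta (milnor_pi f (mvar i)).

Lemma milnor_morphism_subst p :
  theta (milnor_pi f p) = milnor_pi g (subst phi p).
Proof.
have theta1 : theta (milnor_pi f 1) = milnor_pi g 1.
  by rewrite (rmorph1 (milnor_pi f)) (rmorph1 (milnor_pi g)) (rmorph1 theta).
elim/mpoly_ring_ind: p => [c|i p IHp|p q IHp IHq].
- by rewrite substC milnor_piC thetaZ theta1 -milnor_piC.
- rewrite substM substV (rmorphM (milnor_pi f)) (rmorphM (milnor_pi g)).
  by rewrite (rmorphM theta) IHp -Hphi.
- rewrite (raddfD (milnor_pi f)) substD (raddfD (milnor_pi g)).
  by rewrite (rmorphD theta) IHp IHq.
Qed.

Lemma milnor_morphism_ideal : injective theta ->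
  forall p, p \in jacobian_ideal f <-> subst phi p \in jacobian_ideal g.
Proof.
move=> inj p; split=> [/jacobian_ideal_pi pf|/jacobian_ideal_pi pg];
  apply/jacobian_ideal_pi.
  by rewrite -milnor_morphism_subst pf (rmorph0 theta).
by apply: inj; rewrite milnor_morphism_subst pg (rmorph0 theta).
Qed.

Lemma milnor_morphism_preimage : bijective theta ->
  forall q, exists p, subst phi p - q \in jacobian_ideal g.
Proof.
move=> [thetaV _ Vtheta] q; have [p Hp] := milnor_pi_surj (thetaV (milnor_pi g q)).
exists p; apply/milnor_piE.
by rewrite -milnor_morphism_subst Hp Vtheta.
Qed.

End MilnorMorphismSubst.

Section Lifting.
Variables (R : realType) (n : nat) (w : 'I_n -> R) (d : R).
Local Notation C := R[i].
Local Notation A := (mpoly n R[i]).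
Local Notation W := (wpart w).
Implicit Types (f g p q : A) (phi psi : 'I_n -> A).

(** The images of the variables in the graded algebra M(g) are lifted to
    homogeneous polynomials phi_i, and their preimages in M(f) to arbitrary
    polynomials psi_i. *)
Lemma milnor_iso_lift f g : milnor_graded_iso w f g ->
  exists phi psi, [/\ graded w phi,
    forall p, p \in jacobian_ideal f <-> subst phi p \in jacobian_ideal g &
    forall i, subst phi (psi i) - mvar i \in jacobian_ideal g].
Proof.
move=> [theta [thetaZ theta_bij theta_gr]].
have /choice[phi Hphi] : forall i, exists q, W (w i) q /\
    milnor_pi g q = theta (milnor_pi f (mvar i)).
  move=> i; have : milnor_part w f (w i) (milnor_pi f (mvar i)).
    by exists (mvar i) => //; exact: wpartV.
  by move/theta_gr => [q Wq E]; exists q.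
have phiE i := proj2 (Hphi i).
have /choice[psi Hpsi] : forall i, exists q, subst phi q - mvar i \in jacobian_ideal g.
  by move=> i; exact: (milnor_morphism_preimage thetaZ phiE theta_bij (mvar i)).
exists phi, psi; split; [by move=> i; have [] := Hphi i| |exact: Hpsi].
exact: (milnor_morphism_ideal thetaZ phiE (bij_inj theta_bij)).
Qed.

Hypothesis hw : forall i, 0 < w i.

(** A derivative with a nonzero value at 0 is homogeneous with a constant term,
    hence constant. *)
Lemma jacobian_ideal_unit_or f : W d f -> 1 \in jacobian_ideal f \/
  forall i, meval (fun=> 0) (mderiv i f) = 0.
Proof.
move=> Wf; have [|ncrit] := pselect (forall i, meval (fun=> 0) (mderiv i f) = 0).
  by right.
left; move/asboolPn: ncrit => /asboolPn /existsNP[i /eqP nz].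
have := wpart_mderiv i Wf; have [di|di] := eqVneq (d - w i) 0; last first.
  move=> Wi; case/eqP: nz; rewrite meval0E.
  have [//|/Wi] := eqVneq (mcoeff mnm0 (mderiv i f)) 0.
  by rewrite wdeg0 => E; rewrite -E eqxx in di.
rewrite di => /(wpart0_const hw); rewrite -meval0E; set c := meval _ _ in nz * => dE.
have -> : 1 = c^-1 *: mderiv i f.
  by rewrite dE -mul_mpolyC -mpolyCM mulVf // mpolyC1.
by apply: jacobian_idealZ; exact: jacobian_ideal_mderiv.
Qed.

(** At a critical point the linear part of sum h_k * d_k g is the combination
    of the linear parts of the d_k g with coefficients h_k(0). *)
Lemma jac0_ideal g (P : 'I_n -> A) :
    (forall i, meval (fun=> 0) (mderiv i g) = 0) ->
    (forall i, P i \in jacobian_ideal g) ->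
  (jac0 P <= jac0 (fun k => mderiv k g))%MS.
Proof.
move=> crit PJ.
have /choice[h Ph] : forall i, exists h : 'I_n -> A, P i = \sum_(k < n) h k * mderiv k g.
  by move=> i; apply/jacobian_idealP.
apply/submxP.
exists (\matrix_(i, k) meval (fun=> 0) (h i k)); apply/matrixP => i j.
rewrite !mxE Ph (raddf_sum (mderiv j)) (raddf_sum (meval _)); apply: eq_bigr => k _ /=.
by rewrite mderivM mevalD !mevalM crit mulr0 add0r !mxE.
Qed.

(** If J_g is the whole ring, so is J_f, and the identity will do. Otherwise g is
    critical at 0 and the linear part of the lift is completed to an invertible
    one by adding elements of J_g. *)
Lemma milnor_iso_aut f g : W d g -> milnor_graded_iso w f g ->
  exists phi psi, [/\ graded w phi, graded w psi, inverses phi psi &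
    forall p, p \in jacobian_ideal f <-> subst phi p \in jacobian_ideal g].
Proof.
move=> Wg /milnor_iso_lift[phi [psi [gphi Jphi phipsi]]].
have [J1|crit] := jacobian_ideal_unit_or Wg.
  have all_g p : p \in jacobian_ideal g by rewrite -[p]mulr1; exact: jacobian_idealMl.
  exists mvar, mvar; split; [exact: graded_var|exact: graded_var| |].
    by split=> i; rewrite subst_id.
  by move=> p; split=> [_|_]; [|apply/Jphi].
pose H := jac0 (fun k => mderiv k g).
have HL : (jac0 psi *m jac0 phi - 1%:M <= H)%MS.
  rewrite -jac0_comp; last exact: graded_meval0.
  rewrite -jac0_id.
  have -> : jac0 (fun i => subst phi (psi i)) - jac0 mvar =
            jac0 (fun i => subst phi (psi i) - mvar i).
    by apply/matrixP => i j; rewrite !mxE mderivB mevalB.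
  by apply: jac0_ideal => // i; exact: phipsi.
have bH i j : H i j != 0 -> d - w i = w j.
  by rewrite /H jac0E => /(wpart_mderiv i Wg); rewrite wdeg1.
have [Y [bY uY]] := block_complete (fun i j => @jac0_block _ _ _ phi i j gphi) bH HL.
pose phi' i := phi i + \sum_k Y i k *: mderiv k g.
have gphi' : graded w phi'.
  move=> i; apply: wpartD => //; apply: wpart_sum => k _.
  have [->|/bY ->] := eqVneq (Y i k) 0; first by rewrite scale0r; exact: wpart0.
  by apply: wpartZ; exact: wpart_mderiv.
have jphi' : jac0 phi' = jac0 phi + Y *m H.
  apply/matrixP => i j; rewrite !mxE mderivD mevalD (raddf_sum (mderiv j)).
  congr (_ + _); rewrite (raddf_sum (meval (fun=> 0))); apply: eq_bigr => k _.
  by rewrite /= mderivZ mevalZ !mxE.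
have dphi p : subst phi' p - subst phi p \in jacobian_ideal g.
  elim/mpoly_ring_ind: p => [c|i p IHp|p q IHp IHq].
  - by rewrite !substC subrr rpred0.
  - rewrite !substM !substV.
    have -> : phi' i * subst phi' p - phi i * subst phi p =
      (\sum_k Y i k *: mderiv k g) * subst phi' p +
      phi i * (subst phi' p - subst phi p).
      by rewrite mulrDl mulrBr [RHS]addrCA addrA.
    apply: rpredD; last exact: jacobian_idealMl.
    apply: jacobian_idealMr; apply: rpred_sum => k _; apply: jacobian_idealZ.
    exact: jacobian_ideal_mderiv.
  - rewrite (substD phi') (substD phi) opprD addrACA.
    by apply: rpredD; [exact: IHp|exact: IHq].
have uphi' : jac0 phi' \in unitmx by rewrite jphi'; exact: uY.
have [psi' gpsi' inv] := graded_inverse hw gphi' uphi'.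
exists phi', psi'; split; [exact: gphi'|exact: gpsi'|exact: inv|].
move=> p; split=> [/Jphi pJ|pJ].
  by rewrite -[subst phi' p](subrK (subst phi p)); apply: rpredD; [exact: dphi|].
apply/Jphi; rewrite -[subst phi p](subKr (subst phi' p)).
by apply: rpredB; [exact: pJ|exact: dphi].
Qed.

End Lifting.

(** * A submultiplicative norm on polynomials *)

Section ComplexNorm.
Variable R : realType.
Implicit Types x y : R[i].

(** A real-valued norm equivalent to the modulus: it is submultiplicative, and
    estimates on it split into real and imaginary parts. *)
Definition cnorm x : R := `|complex.Re x| + `|complex.Im x|.

Lemma cnorm_ge0 x : 0 <= cnorm x. Proof. exact: addr_ge0. Qed.

Lemma cnorm0 : cnorm 0 = 0. Proof. by rewrite /cnorm /= !normr0 addr0. Qed.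

Lemma cnorm1 : cnorm 1 = 1. Proof. by rewrite /cnorm /= normr1 normr0 addr0. Qed.

Lemma cnorm_real (r : R) : cnorm r%:C%C = `|r|.
Proof. by rewrite /cnorm /= normr0 addr0. Qed.

Lemma cnormN x : cnorm (- x) = cnorm x.
Proof. by case: x => a b; rewrite /cnorm /= !normrN. Qed.

Lemma cnormD x y : cnorm (x + y) <= cnorm x + cnorm y.
Proof.
case: x y => a b [c d]; rewrite /cnorm /= addrACA.
by apply: lerD; exact: ler_normD.
Qed.

Lemma cnormM x y : cnorm (x * y) <= cnorm x * cnorm y.
Proof.
case: x y => a b [c d]; rewrite /cnorm /= mulrDl !mulrDr -!normrM.
rewrite [leRHS](_ : _ = (`|a * c| + `|b * d|) + (`|a * d| + `|b * c|)); last by ring.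
by apply: lerD; [exact: ler_normB|exact: ler_normD].
Qed.

Lemma cnorm_real_mul (r : R) x : cnorm (r%:C%C * x) = `|r| * cnorm x.
Proof. by case: x => a b; rewrite /cnorm /= !mul0r subr0 addr0 !normrM mulrDr. Qed.

Lemma cnormX x k : cnorm (x ^+ k) <= cnorm x ^+ k.
Proof.
elim: k => [|k IHk]; first by rewrite !expr0 cnorm1.
by rewrite !exprS; apply: le_trans (cnormM _ _) _; rewrite ler_wpM2l ?cnorm_ge0.
Qed.

Lemma cnorm_le0 x : cnorm x <= 0 -> x = 0.
Proof.
case: x => a b; rewrite /cnorm /= => le0; apply/eqP; rewrite eq_complex /=.
by apply/andP; split; rewrite -normr_eq0 eq_le normr_ge0 andbT;
  apply: le_trans le0; rewrite ?lerDl ?lerDr.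
Qed.

End ComplexNorm.

Section PolynomialNorm.
Variables (R : realType) (n : nat).
Local Notation C := R[i].
Local Notation A := (mpoly n R[i]).
Implicit Types (p q : A) (m : multinom n).

Definition pnorm p : R := \sum_(m <- msupp p) cnorm (mcoeff m p).

Lemma pnorm_superset (s : seq (multinom n)) p : uniq s -> {subset msupp p <= s} ->
  pnorm p = \sum_(m <- s) cnorm (mcoeff m p).
Proof.
move=> us sub; rewrite [RHS](bigID (fun m => m \in msupp p)) /=.
rewrite [X in _ + X]big1 ?addr0 => [|m]; last first.
  by rewrite -mcoeff_eq0 => /eqP ->; rewrite cnorm0.
rewrite -big_filter; apply: perm_big; apply: uniq_perm.
- exact: msupp_uniq.
- exact: filter_uniq.
- by move=> m; rewrite mem_filter; case: (boolP (m \in msupp p)) => // /sub ->.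
Qed.

Lemma pnorm_ge0 p : 0 <= pnorm p.
Proof. by apply: sumr_ge0 => m _; exact: cnorm_ge0. Qed.

Lemma pnorm0 : pnorm 0 = 0.
Proof.
rewrite (@pnorm_superset [::]) ?big_nil // => m.
by rewrite mcoeff_msupp mcoeff0 eqxx.
Qed.

Lemma pnormD p q : pnorm (p + q) <= pnorm p + pnorm q.
Proof.
pose s := undup (msupp p ++ msupp q).
rewrite !(@pnorm_superset s) ?undup_uniq // => [|m|m|m]; rewrite ?mem_undup ?mem_cat.
- by rewrite -big_split /=; apply: ler_sum => m _; rewrite mcoeffD; exact: cnormD.
- by move=> ->; rewrite orbT.
- by move=> ->.
- by move/msuppD_le; rewrite mem_cat.
Qed.

Lemma pnorm_monomial c m : pnorm (c *: mpolyX C m) <= cnorm c.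
Proof.
rewrite (@pnorm_superset [:: m]) // => [|k /msuppZ_le]; last first.
  by rewrite msuppX.
by rewrite big_seq1 mcoeffZ mcoeffX eqxx mulr1.
Qed.

Lemma pnorm_sum (I : Type) (r : seq I) (P : pred I) (F : I -> A) :
  pnorm (\sum_(i <- r | P i) F i) <= \sum_(i <- r | P i) pnorm (F i).
Proof.
elim/big_ind2: _ => [|a b c d ab cd|//].
  by rewrite pnorm0.
by apply: le_trans (pnormD _ _) _; exact: lerD.
Qed.

Lemma pnormZ c p : pnorm (c *: p) <= cnorm c * pnorm p.
Proof.
rewrite [p in X in X <= _]mpolyE scaler_sumr; apply: le_trans (pnorm_sum _ _ _) _.
rewrite /pnorm mulr_sumr; apply: ler_sum => m _; rewrite scalerA.
by apply: le_trans (pnorm_monomial _ _) _; exact: cnormM.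
Qed.

Lemma pnormN p : pnorm (- p) <= pnorm p.
Proof.
rewrite -scaleN1r; apply: le_trans (pnormZ _ _) _.
by rewrite cnormN cnorm1 mul1r.
Qed.

Lemma pnormBC p q : pnorm (p - q) <= pnorm (q - p).
Proof. by rewrite -opprB; exact: pnormN. Qed.

Lemma pnormM p q : pnorm (p * q) <= pnorm p * pnorm q.
Proof.
rewrite [p in X in X <= _]mpolyE [q in X in X <= _]mpolyE.
rewrite mulr_suml; apply: le_trans (pnorm_sum _ _ _) _.
rewrite [pnorm p]/pnorm mulr_suml; apply: ler_sum => m _.
rewrite mulr_sumr; apply: le_trans (pnorm_sum _ _ _) _.
rewrite /pnorm mulr_sumr; apply: ler_sum => k _.
rewrite -scalerAl -scalerAr scalerA -mpolyXD.
by apply: le_trans (pnorm_monomial _ _) _; exact: cnormM.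
Qed.

Lemma cnorm_mcoeff_le m p : cnorm (mcoeff m p) <= pnorm p.
Proof.
have [mp|] := boolP (m \in msupp p); last first.
  by rewrite -mcoeff_eq0 => /eqP ->; rewrite cnorm0 pnorm_ge0.
rewrite /pnorm (bigD1_seq m) ?msupp_uniq //= lerDl.
by apply: sumr_ge0 => k _; exact: cnorm_ge0.
Qed.

Lemma pnorm_le0 p : pnorm p <= 0 -> p = 0.
Proof.
move=> p0; apply/mpolyP => m; rewrite mcoeff0; apply: cnorm_le0.
exact: le_trans (cnorm_mcoeff_le m p) p0.
Qed.

(** Used to show that the linear part of a substitution close to the identity
    is invertible. *)
Lemma pnorm_linear_coeffs p : \sum_i cnorm (mcoeff (mnm1 i) p) <= pnorm p.
Proof.
pose s := [seq (mnm1 i : multinom n) | i <- index_enum 'I_n].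
have us : uniq s.
  rewrite map_inj_uniq ?index_enum_uniq // => i j /mnmP/(_ i).
  by rewrite !mnm1E eqxx; case: eqP => // ->.
rewrite (@pnorm_superset (undup (s ++ msupp p))) ?undup_uniq //; last first.
  by move=> m mp; rewrite mem_undup mem_cat mp orbT.
rewrite (bigID (fun m => m \in s)) /= -[X in _ <= X + _]big_filter.
rewrite [X in _ <= X + _](perm_big s); last first.
  apply: uniq_perm; rewrite ?filter_uniq ?undup_uniq // => m.
  by rewrite mem_filter mem_undup mem_cat; case: (m \in s).
rewrite /s big_map lerDl; apply: sumr_ge0 => m _; exact: cnorm_ge0.
Qed.

Lemma pnorm_mderiv (B : R) i p : (forall m, m \in msupp p -> (m i)%:R <= B) ->
  pnorm (mderiv i p) <= B * pnorm p.
Proof.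
move=> leB; rewrite [p in X in X <= _]mpolyE raddf_sum.
apply: le_trans (pnorm_sum _ _ _) _; rewrite /pnorm mulr_sumr big_seq [leRHS]big_seq.
apply: ler_sum => m mp /=; rewrite mderivZ mderivX scalerA.
apply: le_trans (pnorm_monomial _ _) _.
rewrite -(rmorph_nat (@real_complex R)) mulrC cnorm_real_mul normr_nat.
by rewrite ler_wpM2r ?cnorm_ge0 ?leB.
Qed.

End PolynomialNorm.

(** * Sums of geometrically bounded series *)

Section RealSeries.
Variables (R : realType) (a rho : R).
Hypothesis rho_le : rho <= 1/4.

(** The partial sums decreased by 2 a rho^K are nondecreasing and those
    increased by 2 a rho^K are nonincreasing; the sum is the cut between them. *)
Lemma real_series_lim (c : nat -> R) : (forall k, `|c k| <= a * rho ^+ k) ->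
  exists l, forall K, `|\sum_(k < K) c k - l| <= 2 * a * rho ^+ K.
Proof.
move=> cb; pose S K := \sum_(k < K) c k.
pose lo K := S K - 2 * a * rho ^+ K; pose up K := S K + 2 * a * rho ^+ K.
have step K : `|c K| + 2 * a * rho ^+ K.+1 <= 2 * a * rho ^+ K.
  have := cb K; rewrite exprS; set t := rho ^+ K => ct.
  have t0 : 0 <= a * t by apply: le_trans ct.
  have : rho * (a * t) <= (1/4) * (a * t) by rewrite ler_wpM2r.
  by lra.
have SS K : S K.+1 = S K + c K by rewrite /S big_ord_recr.
have lo_nd : {homo lo : i j / (i <= j)%N >-> i <= j}.
  apply: homo_leq => [x//|y x z|K]; first exact: le_trans.
  rewrite /lo SS; have := step K; have := lerNnormlW (lexx `|c K|).
  by lra.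
have up_ni : {homo up : i j / (i <= j)%N >-> j <= i}.
  apply: homo_leq => [x//|y x z xy yz|K]; first exact: le_trans yz xy.
  rewrite /up SS; have := step K; have := ler_norm (c K).
  by lra.
have lo_up i j : lo i <= up j.
  have pos K : 0 <= 2 * a * rho ^+ K.
    by have := cb K; have := normr_ge0 (c K); lra.
  have lu K : lo K <= up K by rewrite /lo /up; have := pos K; lra.
  apply: le_trans (lo_nd _ _ (leq_maxl i j)) _.
  exact: le_trans (lu _) (up_ni _ _ (leq_maxr i j)).
pose E := [set lo K | K in [set: nat]]%classic.
have E0 : (E !=set0)%classic by exists (lo 0%N), 0%N.
have Eub j : ubound E (up j) by move=> _ [i _ <-].
exists (sup E) => K; rewrite ler_norml.
have lK : lo K <= sup E by apply: ub_le_sup; [exists (up 0%N); exact: Eub|exists K].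
have uK : sup E <= up K by apply: ge_sup.
by move: lK uK; rewrite /lo /up -/(S K); lra.
Qed.

Lemma complex_series_lim (c : nat -> R[i]) : (forall k, cnorm (c k) <= a * rho ^+ k) ->
  exists l, forall K, cnorm (\sum_(k < K) c k - l) <= 4 * a * rho ^+ K.
Proof.
move=> cb.
have [l1 H1] : exists l, forall K,
    `|\sum_(k < K) complex.Re (c k) - l| <= 2 * a * rho ^+ K.
  apply: (@real_series_lim (fun k => complex.Re (c k))) => k.
  by apply: le_trans (cb k); rewrite /cnorm lerDl.
have [l2 H2] : exists l, forall K,
    `|\sum_(k < K) complex.Im (c k) - l| <= 2 * a * rho ^+ K.
  apply: (@real_series_lim (fun k => complex.Im (c k))) => k.
  by apply: le_trans (cb k); rewrite /cnorm lerDr.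
exists (Complex l1 l2) => K.
have -> : \sum_(k < K) c k =
    Complex (\sum_(k < K) complex.Re (c k)) (\sum_(k < K) complex.Im (c k)).
  by elim/big_rec3: _ => // i x y z _ ->; case: (c i).
by rewrite /cnorm /=; have := H1 K; have := H2 K; lra.
Qed.

End RealSeries.

Section Monomials.
Variables (R : realType) (n : nat) (w : 'I_n -> R).
Hypothesis hw : forall i, 0 < w i.

Lemma mnm_le_wdeg (E : R) (m : multinom n) i : wdeg w m <= E ->
  (m i)%:R <= \sum_j E / w j.
Proof.
move=> mE; have E0 : 0 <= E by apply: le_trans (wdeg_ge0 hw m) mE.
apply: (@le_trans _ _ (E / w i)).
  by rewrite ler_pdivlMr // mulrC; exact: le_trans (wdeg_ge hw m i) mE.
rewrite (bigD1 i) //= lerDl; apply: sumr_ge0 => j _.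
by rewrite divr_ge0 // ltW.
Qed.

Lemma finite_monomials (E : R) :
  exists s : seq (multinom n), uniq s /\ forall m, wdeg w m <= E -> m \in s.
Proof.
pose b := (n * Num.bound (\sum_j E / w j)).+1.
exists [seq bmnm m | m <- index_enum (bmultinom n b)]; split.
  by rewrite map_inj_uniq ?index_enum_uniq //; exact: val_inj.
move=> m mE; have mb : (mdeg m < b)%N.
  rewrite ltnS mdegE; apply: (@leq_trans (\sum_(i < n) Num.bound (\sum_j E / w j))).
    apply: leq_sum => i _; rewrite -(ler_nat R).
    apply: le_trans (mnm_le_wdeg i mE) _; apply: ltW; apply: archi_boundP.
    by apply: le_trans (mnm_le_wdeg i mE); rewrite ler0n.
  by rewrite sum_nat_const card_ord.
by apply/mapP; exists (BMultinom mb); rewrite ?mem_index_enum.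
Qed.

(** The constant M does not depend on the series: only finitely many monomials
    have weighted degree at most E, so coefficientwise bounds add up. The
    uniformity allows rho to be chosen small compared to M. *)
Lemma poly_series_lim (E : R) : exists M : R, 0 <= M /\
  forall (e a rho : R) (u : nat -> mpoly n R[i]), e <= E -> rho <= 1/4 ->
    (forall k, wpart w e (u k)) -> (forall k, pnorm (u k) <= a * rho ^+ k) ->
  exists2 p, wpart w e p & forall K, pnorm (\sum_(k < K) u k - p) <= M * a * rho ^+ K.
Proof.
have [s [us sE]] := finite_monomials E.
exists (4 * (size s)%:R); split=> [|e a rho u eE rho4 Wu ub].
  by rewrite mulr_ge0.
have /choice[l Hl] : forall m, exists l : R[i], forall K,
    cnorm (\sum_(k < K) mcoeff m (u k) - l) <= 4 * a * rho ^+ K.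
  move=> m; apply: (@complex_series_lim R a rho rho4 (fun k => mcoeff m (u k))) => k.
  exact: le_trans (cnorm_mcoeff_le m (u k)) (ub k).
pose s' := [seq m <- s | wdeg w m == e].
have us' : uniq s' by exact: filter_uniq.
pose p := \sum_(m <- s') l m *: mpolyX R[i] m.
have pE m : mcoeff m p = if m \in s' then l m else 0.
  rewrite /p raddf_sum /=; case: ifPn => ms'.
    rewrite (bigD1_seq m) //= mcoeffZ mcoeffX eqxx mulr1 big1 ?addr0 // => k /negPf km.
    by rewrite mcoeffZ mcoeffX km mulr0.
  rewrite big_seq big1 // => k ks'; rewrite mcoeffZ mcoeffX.
  by case: eqP => [km|]; [rewrite -km ks' in ms'|rewrite mulr0].
have Wp : wpart w e p.
  move=> m; rewrite pE; case: ifP => [|_]; last by rewrite eqxx.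
  by rewrite mem_filter => /andP[/eqP].
exists p => // K; set S := \sum_(k < K) u k.
have WS : wpart w e (S - p) by apply: wpartB => //; exact: wpart_sum.
rewrite (@pnorm_superset _ _ s') //; last first.
  move=> m; rewrite mcoeff_msupp => /WS me; rewrite mem_filter me eqxx /=.
  by apply: sE; rewrite me.
apply: (@le_trans _ _ (\sum_(m <- s') 4 * a * rho ^+ K)).
  rewrite big_seq [leRHS]big_seq; apply: ler_sum => m ms'.
  rewrite mcoeffB pE ms' /S raddf_sum; exact: Hl.
rewrite big_const_seq iter_addr_0 count_predT -mulr_natr.
have a0 : 0 <= a * rho ^+ K by apply: le_trans (pnorm_ge0 _) (ub K).
have : a * rho ^+ K * (size s')%:R <= a * rho ^+ K * (size s)%:R.
  by rewrite ler_wpM2l // ler_nat size_filter count_size.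
by lra.
Qed.

End Monomials.

Section SeriesLimit.
Variables (R : realType) (n : nat).
Local Notation A := (mpoly n R[i]).
Implicit Types (p q : A) (u v : nat -> A).

(** Convergence is recorded with a fixed rate, slower than the decay (1/4)^k of
    the terms, so that it is preserved by Cauchy products. *)
Definition sums_to u p :=
  exists M : R, forall K, pnorm (\sum_(k < K) u k - p) <= M * 2^-1 ^+ K.

Lemma half_gt0 K : 0 < 2^-1 ^+ K :> R.
Proof. by rewrite exprn_gt0. Qed.

Lemma sums_to_ext u v p : u =1 v -> sums_to u p -> sums_to v p.
Proof.
by move=> uv [M HM]; exists M => K; under eq_bigr do rewrite -uv.
Qed.

Lemma sums_toD u v p q : sums_to u p -> sums_to v q ->
  sums_to (fun k => u k + v k) (p + q).
Proof.
move=> [M HM] [N HN]; exists (M + N) => K; rewrite big_split /=.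
rewrite opprD addrACA mulrDl; apply: le_trans (pnormD _ _) _.
by apply: lerD; [exact: HM|exact: HN].
Qed.

Lemma sums_toZ c u p : sums_to u p -> sums_to (fun k => c *: u k) (c *: p).
Proof.
move=> [M HM]; exists (cnorm c * M) => K; rewrite -scaler_sumr -scalerBr.
apply: le_trans (pnormZ _ _) _; rewrite -mulrA.
by rewrite ler_wpM2l ?cnorm_ge0 //; exact: HM.
Qed.

Lemma sums_to0 : sums_to (fun=> 0) 0.
Proof. by exists 0 => K; rewrite big1 // subrr pnorm0 mul0r. Qed.

Lemma sums_to_sum (I : eqType) (r : seq I) (U : I -> nat -> A) (P : I -> A) :
    (forall i, i \in r -> sums_to (U i) (P i)) ->
  sums_to (fun k => \sum_(i <- r) U i k) (\sum_(i <- r) P i).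
Proof.
elim: r => [|i r IHr] UP.
  by rewrite big_nil; apply: sums_to_ext sums_to0 => k; rewrite big_nil.
have UPi : sums_to (U i) (P i) by apply: UP; exact: mem_head.
have UPr : forall j, j \in r -> sums_to (U j) (P j).
  by move=> j jr; apply: UP; rewrite inE jr orbT.
rewrite big_cons; apply: sums_to_ext (sums_toD UPi (IHr UPr)) => k.
by rewrite big_cons.
Qed.

Lemma sums_to_const p : sums_to (fun k => if k is 0 then p else 0) p.
Proof.
exists (pnorm p) => -[|K].
  by rewrite big_ord0 sub0r expr0 mulr1; exact: pnormN.
rewrite big_ord_recl /= big1 ?addr0 ?subrr ?pnorm0; last by [].
by apply: mulr_ge0; [exact: pnorm_ge0|apply: ltW; exact: half_gt0].
Qed.

Lemma sums_to_eventually u p q N : sums_to u p ->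
  (forall K, (N <= K)%N -> \sum_(k < K) u k = q) -> p = q.
Proof.
move=> [M HM] uq; apply/esym/eqP; rewrite -subr_eq0; apply/eqP/pnorm_le0.
rewrite leNgt; apply/negP => pq.
pose K := (N + Num.bound (M / pnorm (q - p)%R)%R)%N.
have := HM K; rewrite uq ?leq_addr //; set t := pnorm _ in pq *.
have [M0|M0] := ltP M 0.
  by rewrite leNgt (lt_trans _ pq) // nmulr_rlt0 // half_gt0.
rewrite leNgt exprVn ltr_pdivrMr ?exprn_gt0 // mulrC -ltr_pdivrMr //.
apply/negP/negPn; have /archi_boundP : 0 <= M / t by rewrite divr_ge0 // ltW.
move/lt_trans; apply; rewrite -natrX ltr_nat.
by apply: leq_ltn_trans (ltn_expl K _) => //; rewrite leq_addl.
Qed.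

Definition cauchy_prod u v k := \sum_(i < k.+1) u i * v (k - i)%N.

Lemma sum_cauchy_prod u v K :
  \sum_(k < K) cauchy_prod u v k = \sum_(i < K) u i * \sum_(j < K - i) v j.
Proof.
elim: K => [|K IHK]; first by rewrite !big_ord0.
rewrite big_ord_recr /= IHK /cauchy_prod.
have -> : \sum_(i < K.+1) u i * (\sum_(j < K.+1 - i) v j) =
    \sum_(i < K.+1) (u i * (\sum_(j < K - i) v j) + u i * v (K - i)%N).
  apply: eq_bigr => i _; rewrite -mulrDr subSn; last by rewrite -ltnS.
  by rewrite big_ord_recr.
rewrite big_split /=; congr (_ + _).
by rewrite big_ord_recr /= subnn big_ord0 mulr0 addr0.
Qed.

(** Mertens' theorem with a rate: by [sum_cauchy_prod] the error is the sum of
    the u_i times the tails of v after K - i terms, plus the tail of u times q. *)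
Lemma sums_to_cauchy_prod u v p q (a : R) : (forall k, pnorm (u k) <= a * (1/4) ^+ k) ->
  sums_to u p -> sums_to v q -> sums_to (cauchy_prod u v) (p * q).
Proof.
move=> ua [M HM] [N HN]; exists (2 * a * N + M * pnorm q) => K.
rewrite sum_cauchy_prod.
have a0 : 0 <= a by have := le_trans (pnorm_ge0 _) (ua 0%N); rewrite expr0 mulr1.
have N0 : 0 <= N by have := le_trans (pnorm_ge0 _) (HN 0%N); rewrite expr0 mulr1.
set S := \sum_(i < K) _; set U := \sum_(i < K) u i.
have -> : S - p * q = (S - U * q) + (U - p) * q by rewrite mulrBl addrA subrK.
rewrite [leRHS]mulrDl; apply: le_trans (pnormD _ _) _; apply: lerD; last first.
  apply: le_trans (pnormM _ _) _; rewrite mulrAC.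
  by rewrite ler_wpM2r ?pnorm_ge0 //; exact: HM.
rewrite /U mulr_suml -sumrB; apply: le_trans (pnorm_sum _ _ _) _.
apply: (@le_trans _ _ (\sum_(i < K) (a * N * 2^-1 ^+ K) * 2^-1 ^+ i)).
  apply: ler_sum => i _; rewrite -mulrBr; apply: le_trans (pnormM _ _) _.
  have := ler_pM (pnorm_ge0 _) (pnorm_ge0 _) (ua i) (HN (K - i)%N).
  move/le_trans; apply; rewrite le_eqVlt; apply/orP; left; apply/eqP.
  have -> : 2^-1 ^+ K = 2^-1 ^+ (K - i) * 2^-1 ^+ i :> R.
    by rewrite -exprD subnK // ltnW.
  rewrite (_ : 1/4 = 2^-1 * 2^-1 :> R); last by lra.
  by rewrite exprMn; ring.
have geo : \sum_(i < K) 2^-1 ^+ i <= 2 :> R.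
  suff -> : \sum_(i < K) 2^-1 ^+ i = 2 - 2 * 2^-1 ^+ K :> R.
    by have := half_gt0 K; lra.
  elim: K {HM HN S U} => [|k IHk]; first by rewrite big_ord0 expr0; lra.
  by rewrite big_ord_recr /= IHk exprS; lra.
have -> : 2 * a * N * 2^-1 ^+ K = (a * N * 2^-1 ^+ K) * 2 :> R by ring.
rewrite -mulr_sumr; apply: ler_wpM2l => //.
by rewrite !mulr_ge0 // ltW // half_gt0.
Qed.

End SeriesLimit.

(** * Flows of time-dependent vector fields *)

Section TripleSums.
Variable V : nmodType.
Implicit Type F : nat -> nat -> nat -> V.

(** Both nested sums run over the triples of natural numbers of sum k; the lemma
    expresses the associativity of Cauchy products. *)
Lemma triple_sum F k :
  \sum_(i < k.+1) \sum_(l < i.+1) F l (i - l)%N (k - i)%N =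
  \sum_(a < k.+1) \sum_(b < (k - a).+1) F a b (k - a - b)%N.
Proof.
elim: k F => [|k IHk] F; first by rewrite !big_ord1 /= ?big_ord1 ?subn0.
rewrite big_ord_recr /= subnn.
have -> : \sum_(i < k.+1) \sum_(l < i.+1) F l (i - l)%N (k.+1 - i)%N =
    \sum_(i < k.+1) \sum_(l < i.+1) F l (i - l)%N (k - i).+1.
  apply: eq_bigr => i _; apply: eq_bigr => l _.
  by rewrite subSn // -ltnS.
rewrite (IHk (fun a b c => F a b c.+1)).
rewrite [LHS]addrC [X in X + _]big_ord_recr [RHS]big_ord_recr /= subnn big_ord1 /=.
rewrite addrAC; congr (_ + _).
rewrite -big_split; apply: eq_bigr => a _ /=.
rewrite subSn; last by rewrite -ltnS.
rewrite [RHS]big_ord_recr /= subnn addrC; congr (_ + _).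
by apply: eq_bigr => b _; rewrite subSn // -ltnS.
Qed.

Lemma sum_rev (g : nat -> nat -> V) m :
  \sum_(b < m.+1) g b (m - b)%N = \sum_(b < m.+1) g (m - b)%N b.
Proof.
rewrite (reindex_inj rev_ord_inj); apply: eq_bigr => b _ /=.
by rewrite subSS subKn // -ltnS.
Qed.

Lemma triple_sum_rev F k :
  \sum_(i < k.+1) \sum_(l < i.+1) F l (k - i)%N (i - l)%N =
  \sum_(a < k.+1) \sum_(b < (k - a).+1) F a b (k - a - b)%N.
Proof.
rewrite (triple_sum (fun a b c => F a c b)); apply: eq_bigr => a _.
by rewrite (sum_rev (fun b c => F a c b)).
Qed.

End TripleSums.

Section Flow.
Variables (R : realType) (n : nat).
Local Notation C := R[i].
Local Notation A := (mpoly n R[i]).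
Implicit Types (p q : A) (u v : nat -> A).

Variable a : nat -> 'I_n -> A.

(** The coefficient of s^j of a vector field depending analytically on the time
    s; a j k is the coefficient of s^j in its component along x_k. *)
Definition vfield j p : A := \sum_k a j k * mderiv k p.

Lemma vfieldD j p q : vfield j (p + q) = vfield j p + vfield j q.
Proof.
by rewrite /vfield -big_split; apply: eq_bigr => k _; rewrite mderivD mulrDr.
Qed.

Lemma vfield0 j : vfield j 0 = 0.
Proof. by rewrite /vfield big1 // => k _; rewrite mderiv0 mulr0. Qed.

Lemma vfieldZ j c p : vfield j (c *: p) = c *: vfield j p.
Proof.
by rewrite /vfield scaler_sumr; apply: eq_bigr => k _; rewrite mderivZ scalerAr.
Qed.

Lemma vfield_sum j (I : Type) (r : seq I) (P : pred I) (F : I -> A) :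
  vfield j (\sum_(i <- r | P i) F i) = \sum_(i <- r | P i) vfield j (F i).
Proof. by apply: (big_morph (vfield j) (vfieldD j) (vfield0 j)). Qed.

Lemma vfieldM j p q : vfield j (p * q) = vfield j p * q + p * vfield j q.
Proof.
rewrite /vfield mulr_suml mulr_sumr -big_split; apply: eq_bigr => k _ /=.
rewrite mderivM mulrDr; congr (_ + _); first exact: mulrA.
exact: mulrCA.
Qed.

Lemma vfieldC j c : vfield j (mpolyC n c) = 0.
Proof. by rewrite /vfield big1 // => k _; rewrite mderivC mulr0. Qed.

(** Coefficientwise form of the equation d/ds u = xi_s u, for u the power series
    in s with coefficients u k. *)
Definition flow u := forall k,
  u k.+1 *+ k.+1 = \sum_(i < k.+1) vfield (k - i) (u i).

Lemma mulrSn_inj k : injective (fun p : A => p *+ k.+1).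
Proof.
move=> p q pq; apply/mpolyP => m; have := congr1 (mcoeff m) pq.
by rewrite !mcoeffMn => /eqP; rewrite eqrMn2r //; apply/eqP.
Qed.

Lemma flow_unique u v : flow u -> flow v -> u 0%N = v 0%N -> u =1 v.
Proof.
move=> fu fv uv0 k; have [N] := ubnP k; elim: N k => // N IHN [//|k].
rewrite ltnS => kN; apply: (@mulrSn_inj k) => /=; rewrite fu fv; apply: eq_bigr => i _.
by rewrite IHN //; apply: leq_trans kN.
Qed.

Fixpoint flow_prefix p k : seq A :=
  if k is k'.+1 then
    let s := flow_prefix p k' in
    rcons s (k'.+1%:R^-1 *: \sum_(i < k'.+1) vfield (k' - i) (nth 0 s i))
  else [:: p].

Lemma flow_exists p : exists2 u, flow u & u 0%N = p.
Proof.
pose u k := nth 0 (flow_prefix p k) k.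
have szp k : size (flow_prefix p k) = k.+1.
  by elim: k => //= k IHk; rewrite size_rcons IHk.
have uE k i : (i <= k)%N -> nth 0 (flow_prefix p k) i = u i.
  elim: k => [|k IHk]; first by rewrite leqn0 => /eqP ->.
  rewrite leq_eqVlt => /orP[/eqP -> //|ik] /=.
  by rewrite nth_rcons szp ik IHk.
exists u => // k; rewrite {1}/u /= nth_rcons szp ltnn eqxx -scaler_nat scalerA.
rewrite divff ?scale1r; last by rewrite pnatr_eq0.
by apply: eq_bigr => i _; rewrite uE // -ltnS.
Qed.

Lemma flowZ c u : flow u -> flow (fun k => c *: u k).
Proof.
move=> fu k /=; rewrite scalerMnr fu scaler_sumr; apply: eq_bigr => i _.
by rewrite vfieldZ.
Qed.

Lemma flow_sum (I : Type) (r : seq I) (U : I -> nat -> A) :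
  (forall i, flow (U i)) -> flow (fun k => \sum_(i <- r) U i k).
Proof.
move=> fU k /=; rewrite -sumrMnl (eq_bigr _ (fun i _ => fU i k)).
rewrite exchange_big; apply: eq_bigr => i _.
by rewrite vfield_sum.
Qed.

Lemma flow_const c : flow (fun k => if k is 0 then mpolyC n c else 0).
Proof.
move=> k; rewrite mul0rn big1 // => -[[|i] ltik] _ /=; first exact: vfieldC.
exact: vfield0.
Qed.

(** A vector field acts by derivations, so by Leibniz the product of two
    solutions is a solution: the time-s map is a ring morphism. *)
Lemma flow_cauchy_prod u v : flow u -> flow v -> flow (cauchy_prod u v).
Proof.
move=> fu fv k.
have -> : cauchy_prod u v k.+1 *+ k.+1 =
    \sum_(i < k.+2) u i *+ i * v (k.+1 - i)%N +
    \sum_(i < k.+2) u i * (v (k.+1 - i)%N *+ (k.+1 - i)).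
  rewrite /cauchy_prod -sumrMnl -big_split; apply: eq_bigr => i _ /=.
  by rewrite mulrnAl mulrnAr -mulrnDr subnKC // -ltnS.
rewrite big_ord_recl /= mulr0n mul0r add0r.
rewrite [X in _ + X]big_ord_recr /= subnn mulr0n mulr0 addr0.
have -> : \sum_(i < k.+1) u (bump 0 i) *+ bump 0 i * v (k.+1 - bump 0 i)%N =
    \sum_(i < k.+1) \sum_(l < i.+1) vfield (i - l) (u l) * v (k - i)%N.
  by apply: eq_bigr => i _; rewrite /bump add1n subSS fu mulr_suml.
have -> : \sum_(i < k.+1) u i * (v (k.+1 - i)%N *+ (k.+1 - i)) =
    \sum_(i < k.+1) \sum_(l < (k - i).+1) u i * vfield (k - i - l) (v l).
  apply: eq_bigr => i _; rewrite subSn; last by rewrite -ltnS.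
  by rewrite fv mulr_sumr.
have -> : \sum_(i < k.+1) vfield (k - i) (cauchy_prod u v i) =
    \sum_(i < k.+1) (\sum_(l < i.+1) vfield (k - i) (u l) * v (i - l)%N +
                     \sum_(l < i.+1) u l * vfield (k - i) (v (i - l)%N)).
  apply: eq_bigr => i _; rewrite /cauchy_prod vfield_sum -big_split.
  apply: eq_bigr => l _.
  exact: vfieldM.
rewrite big_split; congr (_ + _) => /=.
  rewrite (triple_sum (fun x y z => vfield y (u x) * v z)).
  by rewrite (triple_sum_rev (fun x y z => vfield y (u x) * v z)).
rewrite (triple_sum_rev (fun x y z => u x * vfield y (v z))).
apply: eq_bigr => i _.
by rewrite (sum_rev (fun b c => u i * vfield b (v c))).
Qed.

Section Bounds.
Variables (w : 'I_n -> R) (Q : R).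
Hypothesis Q_ge0 : 0 <= Q.
Hypothesis Wa : forall j k, wpart w (w k) (a j k).

Lemma wpart_vfield e j p : wpart w e p -> wpart w e (vfield j p).
Proof.
move=> Wp; apply: wpart_sum => k _; rewrite -(addrNK (w k) e) addrC.
by apply: wpartM => //; exact: wpart_mderiv.
Qed.

Lemma wpart_flow e u : flow u -> wpart w e (u 0%N) -> forall k, wpart w e (u k).
Proof.
move=> fu Wu k; have [N] := ubnP k; elim: N k => // N IHN [//|k].
rewrite ltnS => kN; have -> : u k.+1 = k.+1%:R^-1 *: (u k.+1 *+ k.+1).
  by rewrite -[u k.+1 *+ _]scaler_nat scalerA mulVf ?scale1r // pnatr_eq0.
apply: wpartZ; rewrite fu; apply: wpart_sum => i _; apply: wpart_vfield.
by apply: IHN; apply: leq_trans kN.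
Qed.

(** The k + 1 terms defining u_(k+1) are each bounded by Q ^ (k+1) times the norm
    of u 0, and the factor 1 / (k+1) of the integration compensates their number. *)
Lemma pnorm_flow e u : flow u -> wpart w e (u 0%N) ->
    (forall j p, wpart w e p -> pnorm (vfield j p) <= Q ^+ j.+1 * pnorm p) ->
  forall k, pnorm (u k) <= Q ^+ k * pnorm (u 0%N).
Proof.
move=> fu Wu vb k; have [N] := ubnP k; elim: N k => // N IHN [_|k].
  by rewrite expr0 mul1r.
rewrite ltnS => kN; have -> : u k.+1 = k.+1%:R^-1 *: (u k.+1 *+ k.+1).
  by rewrite -[u k.+1 *+ _]scaler_nat scalerA mulVf ?scale1r // pnatr_eq0.
apply: le_trans (pnormZ _ _) _; rewrite -(rmorph_nat (@real_complex R)) -fmorphV.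
rewrite cnorm_real ger0_norm ?invr_ge0 // ler_pdivrMl ?ltr0n // fu.
apply: le_trans (pnorm_sum _ _ _) _.
have -> : k.+1%:R * (Q ^+ k.+1 * pnorm (u 0%N)) =
    \sum_(i < k.+1) Q ^+ k.+1 * pnorm (u 0%N) by rewrite sumr_const card_ord mulr_natl.
apply: ler_sum => i _.
have Wui : wpart w e (u i) by exact: wpart_flow.
apply: (le_trans (vb (k - i)%N (u i) Wui)).
have ik : (i <= k)%N by rewrite -ltnS.
have -> : Q ^+ k.+1 = Q ^+ (k - i).+1 * Q ^+ i by rewrite -exprD addSn subnK.
rewrite -mulrA.
apply: ler_wpM2l; first exact: exprn_ge0.
by apply: IHN; apply: leq_ltn_trans kN.
Qed.

End Bounds.

End Flow.

(** * Integration of graded vector fields *)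

Section FlowIntegration.
Variables (R : realType) (n : nat) (w : 'I_n -> R).
Local Notation C := R[i].
Local Notation A := (mpoly n R[i]).
Implicit Types (p q : A) (u v : nat -> A).
Variables (a : nat -> 'I_n -> A) (E Q : R).
Hypothesis hw : forall i, 0 < w i.
Hypothesis wE : forall i, w i <= E.
Hypothesis Q_gt0 : 0 < Q.
Hypothesis Wa : forall j k, wpart w (w k) (a j k).
Hypothesis vb : forall e j p, e <= E -> wpart w e p ->
  pnorm (vfield a j p) <= Q ^+ j.+1 * pnorm p.

Let sc (s : C) u k : A := s ^+ k *: u k.

Lemma pnorm_scaled_flow s e u : e <= E -> flow a u -> wpart w e (u 0%N) ->
  forall k, pnorm (sc s u k) <= pnorm (u 0%N) * (cnorm s * Q) ^+ k.
Proof.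
move=> eE fu Wu k; apply: le_trans (pnormZ _ _) _.
rewrite exprMn mulrCA; apply: ler_pM; [exact: cnorm_ge0|exact: pnorm_ge0|exact: cnormX|].
rewrite mulrC; apply: (pnorm_flow (ltW Q_gt0) Wa fu Wu) => j p Wp.
exact: vb Wp.
Qed.

Lemma sc_cauchy_prod s u v k :
  sc s (cauchy_prod u v) k = cauchy_prod (sc s u) (sc s v) k.
Proof.
rewrite /sc /cauchy_prod scaler_sumr; apply: eq_bigr => i _.
rewrite -scalerAl -scalerAr scalerA -exprD subnKC //.
by rewrite -ltnS.
Qed.

Lemma pnorm_mvar i : pnorm (mvar i : A) <= 1.
Proof. by rewrite -[mvar i]scale1r -(cnorm1 R); exact: pnorm_monomial. Qed.

(** The substitution phi sends x_i to the sum phi_i of the flow of x_i. Flows are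
    determined by their initial value and compatible with products, so the flow
    of any polynomial sums to its image under phi. Moreover phi_i is close to
    x_i, which makes the linear part of phi invertible. *)
Lemma flow_integration : exists2 r : R, 0 < r & forall s : C, cnorm s < r ->
  exists phi : 'I_n -> A, [/\ graded w phi, jac0 phi \in unitmx &
    forall e v, e <= E -> flow a v -> wpart w e (v 0%N) ->
      sums_to (sc s v) (subst phi (v 0%N))].
Proof.
have [M [M0 HM]] := poly_series_lim hw E.
have QM : 0 < 4 * Q * (1 + M) by rewrite !mulr_gt0 //; lra.
(* This radius gives both rho <= 1/4 and M * rho < 1. *)
exists (4 * Q * (1 + M))^-1 => [|s sr]; first by rewrite invr_gt0.
pose rho := cnorm s * Q.
have rho0 : 0 <= rho by rewrite mulr_ge0 ?cnorm_ge0 // ltW.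
have rhoM : rho * (1 + M) < 1/4.
  have := sr; rewrite -[X in _ < X]mul1r ltr_pdivlMr //.
  by rewrite /rho -!mulrA => H; lra.
have rho4 : rho <= 1/4 by have := mulr_ge0 rho0 M0; lra.
have Mrho : M * rho < 1 by lra.
have /choice[U HU] : forall m : multinom n, exists u, flow a u /\ u 0%N = mpolyX C m.
  by move=> m; have [u] := flow_exists a (mpolyX C m); exists u.
have fU m : flow a (U m) by have [] := HU m.
have U0 m : U m 0%N = mpolyX C m by have [] := HU m.
have WU m : wpart w (wdeg w m) (U m 0%N) by rewrite U0; exact: wpartX.
have UE i k : pnorm (sc s (U (mnm1 i)) k) <= 1 * rho ^+ k.
  have WUi : wpart w (w i) (U (mnm1 i) 0%N) by rewrite -(wdeg1 w); exact: WU.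
  apply: (le_trans (pnorm_scaled_flow s (wE i) (fU _) WUi k)).
  apply: ler_wpM2r; first exact: exprn_ge0.
  by rewrite U0; exact: pnorm_mvar.
have /choice[phi Hphi] : forall i, exists q, wpart w (w i) q /\
    forall K, pnorm (\sum_(k < K) sc s (U (mnm1 i)) k - q) <= M * 1 * rho ^+ K.
  move=> i; have [|q Wq qE] := HM (w i) 1 rho (sc s (U (mnm1 i))) (wE i) rho4 _ (UE i).
    move=> k; apply: wpartZ; apply: wpart_flow => //.
    by rewrite -(wdeg1 w); exact: WU.
  by exists q.
have gphi : graded w phi by move=> i; have [] := Hphi i.
have sums_to_phi i : sums_to (sc s (U (mnm1 i))) (phi i).
  exists M => K; have [_ /(_ K) HK] := Hphi i; apply: le_trans HK _.
  rewrite mulr1; apply: ler_wpM2l => //; apply: lerXn2r; rewrite ?nnegrE //.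
  by apply: le_trans rho4 _; lra.
have sums_to_mon m : wdeg w m <= E -> sums_to (sc s (U m)) (subst phi (mpolyX C m)).
  have [N] := ubnP (mdeg m); elim: N m => // N IHN m mN mE.
  have [m0|mn0] := eqVneq m mnm0.
    have -> : mpolyX C m = mpolyC n 1 by rewrite m0 mpolyX0.
    rewrite substC; apply: sums_to_ext (sums_to_const _) => k.
    have Um : U m 0%N = mpolyC n 1 by rewrite U0 m0 mpolyX0.
    rewrite /sc (flow_unique (fU m) (flow_const a 1) Um k).
    by case: k => [|k]; rewrite /sc ?expr0 ?scale1r // scaler0.
  have [i mi] : exists i, (0 < m i)%N.
    apply/existsP; apply: contraNT mn0; rewrite negb_exists => /forallP m0.
    apply/eqP/mnmP => i; rewrite mnm0E; apply/eqP.
    by rewrite eqn0Ngt.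
  pose m' := mnm_sub m (mnm1 i).
  have mE' : m = mnm_add (mnm1 i) m'.
    apply/mnmP => k; rewrite mnmDE mnmBE subnKC // mnm1E.
    by case: eqP => // <-.
  have Xm : mpolyX C m = mvar i * mpolyX C m' by rewrite {1}mE' mpolyXD.
  rewrite Xm substM substV.
  have prodU : cauchy_prod (U (mnm1 i)) (U m') =1 U m.
    apply: (flow_unique (flow_cauchy_prod (fU _) (fU _)) (fU m)).
    by rewrite /cauchy_prod big_ord1 !U0 Xm.
  have s_eq : cauchy_prod (sc s (U (mnm1 i))) (sc s (U m')) =1 sc s (U m).
    by move=> k; rewrite -sc_cauchy_prod /sc prodU.
  apply: (sums_to_ext s_eq); apply: (@sums_to_cauchy_prod _ _ _ _ _ _ 1).
  - move=> k; apply: le_trans (UE i k) _; rewrite !mul1r.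
    by apply: lerXn2r => //; rewrite ?nnegrE; lra.
  - exact: sums_to_phi.
  - apply: IHN.
      by move: mN; rewrite {1}mE' mdegD mdeg1 add1n ltnS.
    by apply: le_trans mE; rewrite mE' wdegD wdeg1 lerDr ltW.
exists phi; split; [exact: gphi| |].
- apply: unitmx_inj => v vL.
  pose p := \sum_i v 0 i *: (phi i - mvar i).
  have pU j : mcoeff (mnm1 j) p = - v 0 j.
    have := congr1 (fun y : 'rV_n => y 0 j) vL; rewrite !mxE => vLj.
    rewrite /p raddf_sum /=.
    rewrite -[RHS]add0r -[X in _ = X - _]vLj.
    have -> : v 0 j = \sum_i v 0 i * (i == j)%:R.
      rewrite (bigD1 j) //= eqxx mulr1 big1 ?addr0 // => i /negPf ->.
      by rewrite mulr0.
    rewrite -sumrB; apply: eq_bigr => i _.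
    rewrite mcoeffZ mcoeffB mulrBr jac0E; congr (_ - _ * _).
    by rewrite mcoeffXU.
  have phi_near i : pnorm (phi i - mvar i) <= M * rho.
    have [_ /(_ 1%N)] := Hphi i; rewrite big_ord1 /sc expr0 scale1r U0 mulr1 expr1.
    by apply: le_trans; exact: pnormBC.
  have le1 : \sum_j cnorm (v 0 j) <= M * rho * \sum_j cnorm (v 0 j).
    have H := pnorm_linear_coeffs p.
    rewrite (eq_bigr (fun j => cnorm (v 0 j))) in H; last first.
      by move=> j _; rewrite pU cnormN.
    apply: le_trans H _; apply: le_trans (pnorm_sum _ _ _) _.
    rewrite mulr_sumr; apply: ler_sum => i _; apply: le_trans (pnormZ _ _) _.
    by rewrite mulrC; apply: ler_wpM2r; [exact: cnorm_ge0|exact: phi_near].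
  have sum0 : 0 <= \sum_j cnorm (v 0 j) by apply: sumr_ge0 => j _; exact: cnorm_ge0.
  have sumle0 : \sum_j cnorm (v 0 j) <= 0.
    rewrite leNgt; apply/negP => pos; move: le1.
    by rewrite -[X in X <= _]mul1r ler_pM2r // leNgt Mrho.
  apply/rowP => j; rewrite [RHS]mxE; apply: cnorm_le0; apply: le_trans sumle0.
  rewrite (bigD1 j) //= lerDl; apply: sumr_ge0 => i _; exact: cnorm_ge0.
- move=> e v eE fv Wv; set h := v 0%N in Wv *.
  have vE : (fun k => \sum_(m <- msupp h) mcoeff m h *: U m k) =1 v.
    apply: flow_unique => //; first by apply: flow_sum => m; exact: flowZ.
    rewrite -/h [RHS]mpolyE; apply: eq_bigr => m _.
    by rewrite U0.
  have -> : subst phi h = \sum_(m <- msupp h) mcoeff m h *: subst phi (mpolyX C m).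
    rewrite [in LHS](mpolyE h) subst_sum; apply: eq_bigr => m _.
    exact: substZ.
  have sE : (fun k => \sum_(m <- msupp h) mcoeff m h *: sc s (U m) k) =1 sc s v.
    move=> k; rewrite /sc -vE scaler_sumr; apply: eq_bigr => m _.
    by rewrite !scalerA mulrC.
  apply: (sums_to_ext sE).
  apply: (sums_to_sum (U := fun m k => mcoeff m h *: sc s (U m) k)) => m mh.
  apply: sums_toZ; apply: sums_to_mon.
  by rewrite (Wv m) // -mcoeff_msupp.
Qed.

End FlowIntegration.

(** * Local triviality of the deformation *)

Section LocalEquivalence.
Variables (R : realType) (n : nat) (w : 'I_n -> R) (d : R).
Local Notation C := R[i].
Local Notation A := (mpoly n R[i]).
Implicit Types (p q h e : A).
Hypothesis hw : forall i, 0 < w i.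
Hypothesis d_gt0 : 0 < d.

Lemma graded_coefficients h e : wpart w d h -> wpart w d e ->
    (forall i, mderiv i e \in jacobian_ideal h) ->
  exists P : 'I_n -> 'I_n -> A, (forall i j, wpart w (w j - w i) (P i j)) /\
    forall i, mderiv i e = \sum_j P i j * mderiv j h.
Proof.
move=> Wh We eh.
have /choice[c cE] : forall i, exists c : 'I_n -> A,
    mderiv i e = \sum_(j < n) c j * mderiv j h.
  by move=> i; apply/jacobian_idealP.
exists (fun i j => wcomp w (w j - w i) (c i j)); split=> [i j|i].
  exact: wpart_wcomp.
rewrite -(wcomp_id (wpart_mderiv i We)) cE raddf_sum; apply: eq_bigr => j _ /=.
rewrite (wcompMr _ _ (wpart_mderiv j Wh)); congr (wcomp w _ _ * _).
by lra.
Qed.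

Section Field.
Variables (h e : A) (P : 'I_n -> 'I_n -> A).
Hypothesis We : wpart w d e.
Hypothesis WP : forall i j, wpart w (w j - w i) (P i j).
Hypothesis eP : forall i, mderiv i e = \sum_j P i j * mderiv j h.

(** Let (w x / d) be the row with entries (w_i / d) x_i. The field is
    (w x / d) P (1 + s P)^-1, expanded as a geometric series in s: since
    grad e = P grad h, the gradient of h + s e is (1 + s P) grad h, and the field
    maps h + s e to (w x / d) grad e, which is e by the Euler formula. *)
Fixpoint euler_field j k : A :=
  if j is j'.+1 then - \sum_i euler_field j' i * P i k
  else \sum_i (w i / d)%:C%C *: (mvar i * P i k).

Lemma wpart_euler_field j k : wpart w (w k) (euler_field j k).
Proof.
elim: j k => [|j IHj] k /=; last first.
  apply: wpartN; apply: wpart_sum => i _.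
  by have := wpartM (IHj i) (@WP i k); rewrite addrCA subrr addr0.
apply: wpart_sum => i _; apply: wpartZ.
by have := wpartM (wpartV w i) (@WP i k); rewrite addrCA subrr addr0.
Qed.

Lemma euler_field0 : vfield euler_field 0 h = e.
Proof.
rewrite /vfield /=.
have -> : \sum_k (\sum_i (w i / d)%:C%C *: (mvar i * P i k)) * mderiv k h =
    \sum_i (w i / d)%:C%C *: (mvar i * mderiv i e).
  under eq_bigr do rewrite mulr_suml.
  rewrite exchange_big; apply: eq_bigr => i _ /=.
  rewrite eP mulr_sumr scaler_sumr; apply: eq_bigr => k _.
  by rewrite -scalerAl mulrA.
have dd : (d^-1)%:C%C * d%:C%C = 1 :> C.
  by rewrite -rmorphM mulVf ?gt_eqF // rmorph1.
rewrite -[RHS]scale1r -dd -scalerA (euler We) scaler_sumr.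
apply: eq_bigr => i _; rewrite scalerA; congr (_ *: _).
by rewrite -rmorphM mulrC.
Qed.

Lemma euler_fieldS j : vfield euler_field j.+1 h = - vfield euler_field j e.
Proof.
rewrite /vfield /=.
under eq_bigr do rewrite mulNr mulr_suml.
rewrite sumrN exchange_big; congr (- _); apply: eq_bigr => i _ /=.
by rewrite eP mulr_sumr; apply: eq_bigr => k _; rewrite mulrA.
Qed.

(** The path h + s e solves the flow equation, by the two preceding
    identities between coefficients of s. *)
Lemma flow_affine :
  flow euler_field (fun k => if k is 0 then h else if k is 1 then e else 0).
Proof.
case=> [|k]; first by rewrite big_ord1 /= euler_field0.
rewrite mul0rn big_ord_recl big_ord_recl /= big1 ?addr0 => [|i _]; last exact: vfield0.
by rewrite euler_fieldS subn1 addNr.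
Qed.

Let p0 := \sum_i \sum_k pnorm (P i k).
Let c0 := \sum_k pnorm (euler_field 0 k).

Lemma pnorm_euler_field j : \sum_k pnorm (euler_field j k) <= c0 * p0 ^+ j.
Proof.
elim: j => [|j IHj]; first by rewrite expr0 mulr1.
rewrite exprSr mulrA.
apply: (@le_trans _ _ ((\sum_k pnorm (euler_field j k)) * p0)); last first.
  rewrite ler_wpM2r //; apply: sumr_ge0 => i _; apply: sumr_ge0 => k _.
  exact: pnorm_ge0.
rewrite mulr_suml.
apply: (@le_trans _ _ (\sum_k \sum_i pnorm (euler_field j i) * pnorm (P i k))).
  apply: ler_sum => k _ /=; apply: le_trans (pnormN _) _.
  apply: le_trans (pnorm_sum _ _ _) _; apply: ler_sum => i _; exact: pnormM.
rewrite exchange_big; apply: ler_sum => i _ /=; rewrite -mulr_sumr.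
apply: ler_wpM2l; first exact: pnorm_ge0.
rewrite /p0 [leRHS](bigD1 i) //= lerDl; apply: sumr_ge0 => l _; apply: sumr_ge0 => k _.
exact: pnorm_ge0.
Qed.

Lemma pnorm_vfield_euler (E : R) : 0 <= E -> exists2 Q : R, 0 < Q &
  forall (e' : R) j p, e' <= E -> wpart w e' p ->
    pnorm (vfield euler_field j p) <= Q ^+ j.+1 * pnorm p.
Proof.
move=> E0; pose B := \sum_j E / w j.
have p00 : 0 <= p0 by apply: sumr_ge0 => i _; apply: sumr_ge0 => k _; exact: pnorm_ge0.
have c00 : 0 <= c0 by apply: sumr_ge0 => k _; exact: pnorm_ge0.
have B0 : 0 <= B by apply: sumr_ge0 => j _; rewrite divr_ge0 // ltW.
have cB0 := mulr_ge0 c00 B0.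
exists (1 + p0 + c0 * B) => [|e' j p eE Wp]; first by lra.
set Q := 1 + p0 + c0 * B.
apply: (@le_trans _ _ (\sum_k pnorm (euler_field j k) * (B * pnorm p))).
  apply: le_trans (pnorm_sum _ _ _) _; apply: ler_sum => k _.
  apply: le_trans (pnormM _ _) _; apply: ler_wpM2l; first exact: pnorm_ge0.
  apply: pnorm_mderiv => m; rewrite mcoeff_msupp => /Wp mE.
  by apply: mnm_le_wdeg => //; rewrite mE.
rewrite -mulr_suml mulrA; apply: ler_wpM2r; first exact: pnorm_ge0.
apply: le_trans (ler_wpM2r B0 (pnorm_euler_field j)) _.
rewrite mulrAC exprS; apply: ler_pM => //; first exact: exprn_ge0.
  by rewrite /Q; lra.
by apply: lerXn2r; rewrite ?nnegrE /Q; lra.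
Qed.

End Field.

Theorem local_equiv h e : wpart w d h -> wpart w d e ->
    (forall i, mderiv i e \in jacobian_ideal h) ->
  exists2 r : R, 0 < r & forall s : C, cnorm s < r -> graded_equiv w h (h + s *: e).
Proof.
move=> Wh We eh; have [P [WP eP]] := graded_coefficients Wh We eh.
pose E := d + \sum_i w i.
have sw0 : 0 <= \sum_i w i by apply: sumr_ge0 => i _; exact: ltW.
have dE : d <= E by rewrite /E lerDl.
have wE i : w i <= E.
  apply: le_trans (_ : \sum_i w i <= _); last by rewrite /E lerDr ltW.
  by rewrite (bigD1 i) //= lerDl; apply: sumr_ge0 => j _; exact: ltW.
have E0 : 0 <= E by apply: le_trans dE; exact: ltW.
have [Q Q0 vb] := pnorm_vfield_euler P E0.
have [r r0 Hr] := flow_integration hw wE Q0 (wpart_euler_field WP) vb.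
exists r => // s /Hr[phi [gphi uphi phi_flow]].
have := phi_flow d _ dE (flow_affine We eP) Wh.
move=> /(sums_to_eventually (q := h + s *: e) (N := 2)) phi_h.
have [psi gpsi inv] := graded_inverse hw gphi uphi.
exists phi, psi; split; [exact: gphi|exact: gpsi|exact: inv|].
apply: phi_h => -[//|[//|K]] _.
rewrite 2!big_ord_recl /= big1 ?addr0 => [|i _]; last by rewrite scaler0.
by rewrite expr0 expr1 scale1r.
Qed.

End LocalEquivalence.

(** * Deformation along a complex path *)

Section Deformation.
Variables (R : realType) (n : nat) (w : 'I_n -> R) (d : R).
Local Notation C := R[i].
Local Notation A := (mpoly n R[i]).
Implicit Types (p q f g e : A).
Hypothesis hw : forall i, 0 < w i.
Hypothesis d_gt0 : 0 < d.

(** In every term of the determinant the degrees w_(s i) - w_i cancel. *)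
Lemma wpart_det (N : 'M[A]_n) :
  (forall i j, wpart w (w j - w i) (N i j)) -> wpart w 0 (\det N).
Proof.
move=> WN; rewrite /determinant; apply: wpart_sum => s _.
rewrite -signr_odd mulr_sign.
suff Wp : wpart w 0 (\prod_i N i (s i)) by case: ifP => _ //; exact: wpartN.
have s0 : \sum_i (w (s i) - w i) = 0.
  by rewrite sumrB [X in _ - X](reindex_inj (@perm_inj _ s)) subrr.
rewrite -s0; apply: (big_rec2 (fun p x => wpart w x p)); first exact: wpart1.
by move=> i p x _ Wp; apply: wpartM.
Qed.

(** Writing grad e = B grad f, the gradient of f + t e is N grad f with
    N = 1 + t B, and the determinant of N is a constant by degree reasons, equal
    to its value D(t) at the origin. When D(t) is nonzero N is invertible. *)
Lemma jacobian_ideal_pencil f e : wpart w d f -> wpart w d e ->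
    (forall i, mderiv i e \in jacobian_ideal f) ->
  exists2 D : {poly C}, D.[0] = 1 &
    forall t : C, D.[t] != 0 -> forall i, mderiv i e \in jacobian_ideal (f + t *: e).
Proof.
move=> Wf We ef; have [B [WB eB]] := graded_coefficients Wf We ef.
pose B0 : 'M[C]_n := \matrix_(i, j) meval (fun=> 0) (B i j).
pose D : {poly C} := \det (1%:M + 'X *: map_mx polyC B0).
have DE t : D.[t] = \det (1%:M + t *: B0).
  rewrite -[D.[t]]/(horner_eval t D) -det_map_mx; congr (\det _).
  apply/matrixP => i j; rewrite !mxE /= /horner_eval hornerD hornerM hornerX hornerC.
  by congr (_ + _); case: (i == j); rewrite ?hornerC ?horner0 // -[1]/(1%:P) hornerC.
exists D => [|t Dt i]; first by rewrite DE scale0r addr0 det1.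
pose N : 'M[A]_n := \matrix_(i, j) ((i == j)%:R + t *: B i j).
have WN j k : wpart w (w k - w j) (N j k).
  rewrite mxE; apply: wpartD; last by apply: wpartZ; exact: WB.
  have [->|_] := eqVneq j k; last exact: wpart0.
  by rewrite subrr; exact: wpart1.
have detN : \det N = mpolyC n D.[t].
  rewrite (wpart0_const hw (wpart_det WN)) -meval0E DE; congr (mpolyC n _).
  rewrite -det_map_mx; congr (\det _); apply/matrixP => j k.
  by rewrite !mxE /= mevalD mevalZ rmorph_nat.
have dft j : mderiv j (f + t *: e) = \sum_k N j k * mderiv k f.
  rewrite mderivD mderivZ eB scaler_sumr.
  under [RHS]eq_bigr do rewrite mxE mulrDl.
  rewrite big_split /=; congr (_ + _).
    rewrite (bigD1 j) //= eqxx mul1r big1 ?addr0 // => k /negPf.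
    by rewrite eq_sym => ->; rewrite mul0r.
  by apply: eq_bigr => k _; rewrite scalerAl.
have Jf j : mderiv j f \in jacobian_ideal (f + t *: e).
  have -> : mderiv j f = D.[t]^-1 *: \sum_k (\adj N) j k * mderiv k (f + t *: e).
    under eq_bigr do rewrite dft mulr_sumr.
    rewrite exchange_big /=.
    have -> : \sum_l \sum_k (\adj N) j k * (N k l * mderiv l f) =
              \sum_l ((\adj N *m N) j l) * mderiv l f.
      apply: eq_bigr => l _; rewrite mxE mulr_suml; apply: eq_bigr => k _.
      exact: mulrA.
    rewrite mul_adj_mx (bigD1 j) //= big1 ?addr0 => [|l /negPf lj].
      rewrite mxE eqxx mulr1n detN mul_mpolyC scalerA mulVf // scale1r //.
    by rewrite mxE eq_sym lj mulr0n mul0r.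
  apply: jacobian_idealZ; apply: rpred_sum => k _; apply: jacobian_idealMl.
  exact: jacobian_ideal_mderiv.
rewrite eB; apply: rpred_sum => j _; apply: jacobian_idealMl; exact: Jf.
Qed.

(** Connectedness of the unit interval, for the equivalence relation P whose
    classes are open. *)
Lemma real_segment_connect (P : R -> R -> Prop) :
    (forall x, P x x) -> (forall x y, P x y -> P y x) ->
    (forall x y z, P x y -> P y z -> P x z) ->
    (forall x, 0 <= x <= 1 -> exists2 r, 0 < r & forall y, `|y - x| < r -> P x y) ->
  P 0 1.
Proof.
move=> Prefl Psym Ptrans Ploc.
pose S := [set x : R | 0 <= x <= 1 /\ P 0 x]%classic.
have S0 : S 0 by split; [lra|exact: Prefl].
have Sub : ubound S 1 by move=> x [/andP[]].
have hS : has_sup S by split; [exists 0|exists 1].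
have x0 : 0 <= sup S by apply: ub_le_sup => //; exists 1.
have x1 : sup S <= 1 by apply: ge_sup => //; exists 0.
have [r r0 Hr] := Ploc (sup S) (introT andP (conj x0 x1)).
have Psup : P 0 (sup S).
  have [y Sy yr] := sup_adherent r0 hS.
  apply: (Ptrans _ y); first exact: (proj2 Sy).
  apply: Psym; apply: Hr.
  have ys : y <= sup S by apply: ub_le_sup; [exists 1|].
  by rewrite ler0_norm; lra.
have [<-//|s1] := eqVneq (sup S) 1.
have {}s1 : sup S < 1 by rewrite lt_neqAle s1.
pose y := Num.min 1 (sup S + r / 2).
have Sy : S y.
  split; first by rewrite /y; case: (leP 1 (sup S + r / 2)) => h; apply/andP; split; lra.
  apply: (Ptrans _ (sup S)) => //; apply: Hr.
  by rewrite /y; case: (leP 1 (sup S + r / 2)) => h; rewrite ger0_norm; lra.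
have : y <= sup S by apply: ub_le_sup => //; exists 1.
by rewrite /y; case: (leP 1 (sup S + r / 2)) => h; lra.
Qed.

Lemma graded_equiv_segment f e (D : {poly C}) (b : C) :
    wpart w d f -> wpart w d e ->
    (forall t : C, D.[t] != 0 -> forall i, mderiv i e \in jacobian_ideal (f + t *: e)) ->
    (forall x : R, 0 <= x <= 1 -> D.[x%:C%C * b] != 0) ->
  graded_equiv w f (f + b *: e).
Proof.
move=> Wf We HD Db.
pose P (x y : R) := graded_equiv w (f + (x%:C%C * b) *: e) (f + (y%:C%C * b) *: e).
suff : P 0 1 by rewrite /P rmorph0 rmorph1 mul0r mul1r scale0r addr0.
apply: real_segment_connect => [x|x y|x y z|x x01].
- exact: graded_equiv_refl.
- exact: graded_equiv_sym.
- exact: graded_equiv_trans.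
have Wh : wpart w d (f + (x%:C%C * b) *: e) by apply: wpartD => //; exact: wpartZ.
have [r r0 Hr] := local_equiv hw d_gt0 Wh We (HD _ (Db _ x01)).
have b0 : 0 < cnorm b + 1 by have := cnorm_ge0 b; lra.
exists (r / (cnorm b + 1)) => [|y]; first exact: divr_gt0.
rewrite ltr_pdivlMr // => yx.
have -> : P x y = graded_equiv w (f + (x%:C%C * b) *: e)
    (f + (x%:C%C * b) *: e + ((y - x)%:C%C * b) *: e).
  rewrite /P; congr (graded_equiv w _ _).
  by rewrite -addrA -scalerDl -mulrDl -rmorphD [x + _]addrC subrK.
apply: Hr; rewrite cnorm_real_mul; apply: le_lt_trans yx.
by apply: ler_wpM2l => //; lra.
Qed.

(** A root c of D can lie on the segment from 0 to 1/2 + i l only if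
    l = Im c / (2 Re c). *)
Lemma avoid_roots (D : {poly C}) : D.[0] != 0 ->
  exists s : seq R, forall l, l \notin s ->
    forall x : R, 0 <= x <= 1 -> D.[x%:C%C * Complex (1/2) l] != 0.
Proof.
move=> D0; have [r Dr] := closed_field_poly_normal D.
exists [seq complex.Im c / (2 * complex.Re c) | c <- r] => l lr x _.
apply: contra lr => /eqP Dx.
have x0 : x != 0 by apply: contraNneq D0 => x0; move: Dx; rewrite x0 rmorph0 mul0r => ->.
have lc0 : lead_coef D != 0.
  by rewrite lead_coef_eq0; apply: contraNneq D0 => ->; rewrite horner0.
have : root D (x%:C%C * Complex (1/2) l) by apply/eqP.
rewrite Dr rootZ // root_prod_XsubC => cr.
apply/mapP; exists (x%:C%C * Complex (1/2) l) => //=.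
by field.
Qed.

(** The pencils issued from f and from g meet at the parameter 1/2 + i l of the
    first, which is the parameter 1/2 - i l of the second. *)
Theorem jacobian_ideal_equiv f g : wpart w d f -> wpart w d g ->
    (forall i, mderiv i f \in jacobian_ideal g) ->
    (forall i, mderiv i g \in jacobian_ideal f) ->
  graded_equiv w f g.
Proof.
move=> Wf Wg fg gf.
have gfJ i : mderiv i (g - f) \in jacobian_ideal f.
  by rewrite mderivB; apply: rpredB; [exact: gf|exact: jacobian_ideal_mderiv].
have fgJ i : mderiv i (f - g) \in jacobian_ideal g.
  by rewrite mderivB; apply: rpredB; [exact: fg|exact: jacobian_ideal_mderiv].
have Wgf : wpart w d (g - f) by exact: wpartB.
have Wfg : wpart w d (f - g) by exact: wpartB.
have [D1 D10 HD1] := jacobian_ideal_pencil Wf Wgf gfJ.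
have [D2 D20 HD2] := jacobian_ideal_pencil Wg Wfg fgJ.
have [s1 Hs1] : exists s : seq R, forall l, l \notin s ->
    forall x : R, 0 <= x <= 1 -> D1.[x%:C%C * Complex (1/2) l] != 0.
  by apply: avoid_roots; rewrite D10 oner_neq0.
have [s2 Hs2] : exists s : seq R, forall l, l \notin s ->
    forall x : R, 0 <= x <= 1 -> D2.[x%:C%C * Complex (1/2) l] != 0.
  by apply: avoid_roots; rewrite D20 oner_neq0.
(* l and - l avoid the finitely many bad values on either side. *)
pose l : R := 1 + \sum_(x <- s1 ++ s2) `|x|.
have big x : x \in s1 ++ s2 -> `|x| < l.
  move=> xs; rewrite /l (big_rem x) //=.
  have : 0 <= \sum_(y <- rem x (s1 ++ s2)) `|y| by apply: sumr_ge0.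
  by lra.
have l1 : l \notin s1.
  apply/negP => ls; have : `|l| < l by apply: big; rewrite mem_cat ls.
  by rewrite ltNge ler_norm.
have l2 : - l \notin s2.
  apply/negP => ls; have : `|- l| < l by apply: big; rewrite mem_cat ls orbT.
  by rewrite normrN ltNge ler_norm.
have E1 := graded_equiv_segment Wf Wgf HD1 (Hs1 _ l1).
have E2 := graded_equiv_segment Wg Wfg HD2 (Hs2 _ l2).
apply: graded_equiv_trans E1 _; apply: graded_equiv_sym.
have -> : f + Complex (1/2) l *: (g - f) =
    g + Complex (1/2) (- l) *: (f - g); last exact: E2.
have -> : Complex (1/2) (- l) = 1 - Complex (1/2) l :> C.
  by apply/eqP; rewrite eq_complex /=; apply/andP; split; apply/eqP; lra.
rewrite scalerBl scale1r addrA [g + (f - g)]addrC subrK.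
by rewrite -[g - f]opprB scalerN.
Qed.

End Deformation.

Theorem corollary3 (R : realType) (n : nat) (w : 'I_n -> R) (d : R)
    (f g : mpoly n R[i]) (hn : (0 < n)%N) (hw : forall i, 0 < w i)
    (hf0 : meval (fun=> 0) f = 0) (hg0 : meval (fun=> 0) g = 0)
    (hf : weighted_homogeneous w d f) (hg : weighted_homogeneous w d g) :
  milnor_graded_iso w f g -> right_equivalent f g.
Proof.
have Wf := weighted_homogeneous_wpart hf; have Wg := weighted_homogeneous_wpart hg.
move=> iso; apply: (@graded_equiv_right _ _ w).
(* In nonpositive degree there are only constants, and f and g vanish at 0. *)
have [d_gt0|d_le0] := ltP 0 d; last first.
  have zero h : meval (fun=> 0) h = 0 -> wpart w d h -> h = 0.
    move=> h0 Wh; have [d0|d0] := eqVneq d 0.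
      have W0 : wpart w 0 h by rewrite -d0.
      by rewrite (wpart0_const hw W0) -meval0E h0 mpolyC0.
    by apply: wpart_nonpos hw _ _ _ Wh; rewrite lt_neqAle d0.
  by rewrite (zero f hf0 Wf) (zero g hg0 Wg); exact: graded_equiv_refl.
have [phi [psi [gphi gpsi inv Jphi]]] := milnor_iso_aut hw Wg iso.
have E1 : graded_equiv w f (subst phi f) by exists phi, psi; split.
have Wf' : wpart w d (subst phi f) by exact: wpart_subst.
have fJ j : subst phi (mderiv j f) \in jacobian_ideal g.
  exact: (proj1 (Jphi _) (jacobian_ideal_mderiv f j)).
have [inv1 inv2] := inv.
have gJ i : subst psi (mderiv i g) \in jacobian_ideal f.
  apply: (proj2 (Jphi _)); rewrite (substK inv1).
  exact: jacobian_ideal_mderiv.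
have gJ' i : mderiv i g \in jacobian_ideal (subst phi f).
  rewrite -(substK inv1 (mderiv i g)).
  exact: (jacobian_ideal_aut inv1 inv2 (gJ i)).
apply: graded_equiv_trans E1 _.
exact: (jacobian_ideal_equiv hw d_gt0 Wf' Wg (mderiv_subst_ideal fJ) gJ').
Qed.
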